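(* Let $n,k,r$ be integers with $k\geq 2$, $3\leq r\leq 2k$ and $n\geq 2(r+2)(r+1)(r+2k)$. If $G$ is an $n$-vertex $C_{2k+1}$-free graph with $$e(G)\geq \left\lfloor\frac{(n-r+1)^2}{4}\right\rfloor+\binom{r}{2},$$ then $$d_2(G)\leq r-2 \quad\text{and}\quad \gamma_2(G)\leq \binom{\lfloor r/2\rfloor}{2}+\binom{\lceil r/2\rceil}{2},$$ and equality holds in either of these two bounds if and only if $G=T^*(r,n)$.
   Context: All graphs are finite and simple, and $e(G)$ denotes the number of edges of $G$. A graph is $C_{2k+1}$-free if it does not contain a cycle of length $2k+1$ as a (not necessarily induced) subgraph. Define $$d_2(G)=\min\{|T| : T\subseteq V(G),\ G-T\text{ is bipartite}\},\qquad \gamma_2(G)=\min\{|E| : E\subseteq E(G),\ G-E\text{ is bipartite}\},$$ where $G-T$ is obtained by deleting the vertices in $T$ and $G-E$ by deleting the edges in $E$. The graph $T^*(r,n)$ is the $n$-vertex graph consisting of a complete bipartite graph $K_{\lfloor\frac{n-r+1}{2}\rfloor,\lceil\frac{n-r+1}{2}\rceil}$ and a complete graph $K_r$ sharing exactly one vertex (and with no other edges). The shared vertex may lie in either part of the complete bipartite graph, and $G=T^*(r,n)$ means that $G$ is isomorphic to a graph of this form. *)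

(* Defs.v *)
From mathcomp Require Import all_boot.

Set Implicit Arguments.
Unset Strict Implicit.
Unset Printing Implicit Defensive.

Record sgraph := SGraph {
  vertex :> finType;
  adj : rel vertex;
  adj_sym : symmetric adj;
  adj_irr : irreflexive adj
}.

Definition edges (G : sgraph) : {set {set G}} :=
  [set [set p.1; p.2] | p : G * G & adj p.1 p.2].

(* For m >= 3, the lists below are exactly the traversals of the copies of C_m
   in G, induced or not. *)
Definition cycle_free (m : nat) (G : sgraph) : Prop :=
  ~ exists s : seq G, size s = m /\ ucycle (@adj G) s.

Definition bipartite (G : sgraph) : bool :=
  [exists A : {set G}, forall x, forall y,
     adj x y ==> ((x \in A) != (y \in A))].

Section Deletion.
Variable G : sgraph.

Section Vertices.
Variable S : {set G}.
Definition del_vertices_adj : rel {x : G | x \notin S} :=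
  fun x y => adj (val x) (val y).
Lemma del_vertices_sym : symmetric del_vertices_adj.
Proof. by move=> x y; apply: adj_sym. Qed.
Lemma del_vertices_irr : irreflexive del_vertices_adj.
Proof. by move=> x; apply: adj_irr. Qed.
Definition del_vertices : sgraph := SGraph del_vertices_sym del_vertices_irr.
End Vertices.

Section Edges.
Variable E : {set {set G}}.
Definition del_edges_adj : rel G :=
  fun x y => adj x y && ([set x; y] \notin E).
Lemma del_edges_sym : symmetric del_edges_adj.
Proof. by move=> x y; rewrite /del_edges_adj adj_sym setUC. Qed.
Lemma del_edges_irr : irreflexive del_edges_adj.
Proof. by move=> x; rewrite /del_edges_adj adj_irr. Qed.
Definition del_edges : sgraph := SGraph del_edges_sym del_edges_irr.
End Edges.

End Deletion.

Definition d2 (G : sgraph) : nat :=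
  #|[arg min_(S < [set: G] | bipartite (del_vertices S)) #|S|]|.

Definition gamma2 (G : sgraph) : nat :=
  #|[arg min_(E < edges G | (E \subset edges G) && bipartite (del_edges E))
       #|E|]|.

(* The default values of the two arg min are admissible, so d2 and gamma2 are
   genuine minima. *)
Lemma bipartite_del_setT (G : sgraph) : bipartite (del_vertices [set: G]).
Proof.
apply/existsP; exists set0; apply/forallP => x.
by have := valP x; rewrite /= inE.
Qed.

Lemma bipartite_del_edges (G : sgraph) : bipartite (del_edges (edges G)).
Proof.
apply/existsP; exists set0; apply/forallP => x; apply/forallP => y.
by apply/implyP => /= /andP[xy] /imsetP[]; exists (x, y); rewrite ?inE.
Qed.

Lemma d2P (G : sgraph) (m : nat) :
  d2 G = m <->
  (exists2 S : {set G}, bipartite (del_vertices S) & #|S| = m) /\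
  (forall S : {set G}, bipartite (del_vertices S) -> m <= #|S|).
Proof.
rewrite /d2; case: arg_minnP => [|S bS minS]; first exact: bipartite_del_setT.
split=> [<-|[[U bU <-] minU]]; first by split=> //; exists S.
by apply/eqP; rewrite eqn_leq minS ?minU.
Qed.

Lemma gamma2P (G : sgraph) (m : nat) :
  gamma2 G = m <->
  (exists E : {set {set G}},
     [/\ E \subset edges G, bipartite (del_edges E) & #|E| = m]) /\
  (forall E : {set {set G}},
     E \subset edges G -> bipartite (del_edges E) -> m <= #|E|).
Proof.
rewrite /gamma2; case: arg_minnP => [|E /andP[sE bE] minE].
  by rewrite subxx bipartite_del_edges.
split=> [<-|[[F [sF bF <-]] minF]].
  by split=> [|F sF bF]; [exists E | apply: minE; rewrite sF].
by apply/eqP; rewrite eqn_leq minE ?sF ?bF ?minF.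
Qed.

(* The property "G is isomorphic to T^*(r, n)", stated inside G: A and B are the
   parts of the complete bipartite graph, K is the clique K_r, and the shared
   vertex v may lie in A or in B, whose sizes may differ by one. *)
Definition is_Tstar (r n : nat) (G : sgraph) : Prop :=
  #|G| = n /\
  exists (A B K : {set G}) (v : G),
    [/\ [disjoint A & B], (A :|: B) :&: K = [set v] &
        (A :|: B) :|: K = [set: G]] /\
    [/\ #|A| = (n - r + 1)./2, #|B| = uphalf (n - r + 1) & #|K| = r] /\
    (forall x y : G,
       adj x y = [|| (x \in A) && (y \in B), (x \in B) && (y \in A) |
                     [&& x \in K, y \in K & x != y]]).

(* Main.v *)
Require Import Defs.
From mathcomp Require Import all_boot zify.

(* A vertex of maximum degree gives a bipartition of V(G), namely its
   neighbourhood against the rest, which misses few cross pairs: its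
   neighbourhood contains no path on 2k vertices and so spans O(kn) edges.
   Vertices adjacent to more than half of one side have pairwise many common
   neighbours, hence are joined by paths of all short even lengths, and
   C_{2k+1}-freeness makes the set A of vertices with enough neighbours among
   them independent; the same holds for the other side, giving B.  Repeating
   this once with (A, B) as the starting bipartition leaves at most r - 1
   vertices outside A and B, each attached to only one side.

   Two adjacent outside vertices attached to the same side must be attached to
   one and the same single vertex.  So either the outside vertices form a
   clique hanging on one vertex w of the core, or two of them can be kept
   without creating an odd cycle.  In the second case d_2 <= p - 2 for p
   outside vertices, and adding the remaining ones greedily to a bipartition
   costs at most half of the degree each time, which telescopes to the bound on
   gamma_2 with strict inequality.  In the first case counting edges shows
   p < r - 1 or G = T^*(r, n), and in T^*(r, n) the clique K_r gives the lower
   bounds. *)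

Set Implicit Arguments.
Unset Strict Implicit.
Unset Printing Implicit Defensive.

(** * Degrees and edge counts *)

Section Counting.
Variable G : sgraph.
Implicit Types (x y : G) (X Y Z : {set G}).

Definition nbr x : {set G} := [set y | adj x y].
Definition deg x Y : nat := #|nbr x :&: Y|.
(** Ordered pairs are counted, so an edge inside both [X] and [Y] counts twice. This is why edge
    counts below appear doubled. *)
Definition pairs X Y : nat := \sum_(x in X) deg x Y.
Definition missing X Y : nat := #|X| * #|Y| - pairs X Y.

Lemma in_nbr x y : (y \in nbr x) = adj x y.
Proof. by rewrite inE. Qed.

Lemma adj_neq x y : adj x y -> x != y.
Proof. by apply: contraTneq => ->; rewrite adj_irr. Qed.

Lemma deg_le x Y : deg x Y <= #|Y|.
Proof. by rewrite subset_leq_card ?subsetIr. Qed.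

Lemma deg_sub x X Y : X \subset Y -> deg x X <= deg x Y.
Proof. by move=> XY; rewrite subset_leq_card ?setIS. Qed.

Lemma deg_ID x X Y : deg x X = deg x (X :&: Y) + deg x (X :\: Y).
Proof. by rewrite /deg -(cardsID Y) setIA setIDA. Qed.

Lemma deg_U x X Y : deg x (X :|: Y) <= deg x X + deg x Y.
Proof. by rewrite /deg setIUr cardsU leq_subr. Qed.

Lemma deg_U_disjoint x X Y :
  [disjoint X & Y] -> deg x (X :|: Y) = deg x X + deg x Y.
Proof.
move=> dXY; rewrite (deg_ID x (X :|: Y) X) setUK setDUl setDv set0U.
by rewrite (setDidPl _) // disjoint_sym.
Qed.

Lemma deg_eq0 x Y : reflect (forall y, y \in Y -> ~~ adj x y) (deg x Y == 0).
Proof.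
rewrite cards_eq0; apply: (iffP eqP) => [e y yY | h].
  apply/negP => xy; have: y \in nbr x :&: Y by rewrite !inE xy yY.
  by rewrite e inE.
apply/setP=> y; rewrite !inE; apply/negbTE/negP => /andP[xy yY].
by move: (h y yY); rewrite xy.
Qed.

Lemma deg_self x Y : x \in Y -> deg x Y <= #|Y|.-1.
Proof.
move=> xY; rewrite (cardsD1 x Y) xY /= subset_leq_card //.
apply/subsetP=> y; rewrite !inE => /andP[/adj_neq xy ->].
by rewrite eq_sym xy.
Qed.

Lemma degE x Y : deg x Y = \sum_(y in Y) adj x y.
Proof.
rewrite /deg -sum1_card big_mkcond [RHS]big_mkcond /=.
by apply: eq_bigr => y _; rewrite !inE andbC; case: (y \in Y); case: adj.
Qed.

Lemma pairsC X Y : pairs X Y = pairs Y X.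
Proof.
rewrite /pairs; under eq_bigr do rewrite degE.
rewrite exchange_big; apply: eq_bigr => y _; rewrite degE.
by apply: eq_bigr => x _; rewrite adj_sym.
Qed.

Lemma pairs_le X Y : pairs X Y <= #|X| * #|Y|.
Proof.
by rewrite /pairs -sum_nat_const; apply: leq_sum => x _; apply: deg_le.
Qed.

Lemma missingC X Y : missing X Y = missing Y X.
Proof. by rewrite /missing pairsC mulnC. Qed.

Lemma missingE X Y : pairs X Y + missing X Y = #|X| * #|Y|.
Proof. by rewrite subnKC ?pairs_le. Qed.

Lemma missing_sum X Y : missing X Y = \sum_(x in X) (#|Y| - deg x Y).
Proof.
apply/eqP; rewrite -(eqn_add2l (pairs X Y)) missingE -big_split /=.
rewrite -sum_nat_const; apply/eqP/eq_bigr => x _.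
by rewrite subnKC ?deg_le.
Qed.

Lemma pairs_const X Y d :
  (forall x, x \in X -> deg x Y <= d) -> pairs X Y <= #|X| * d.
Proof. by move=> h; rewrite -sum_nat_const; apply: leq_sum. Qed.

Lemma pairs_Ul X1 X2 Y :
  [disjoint X1 & X2] -> pairs (X1 :|: X2) Y = pairs X1 Y + pairs X2 Y.
Proof.
move=> d; rewrite /pairs (big_setID X1) /= setUK setDUl setDv set0U.
by rewrite (setDidPl _) // disjoint_sym.
Qed.

Lemma pairs_Ur X Y1 Y2 :
  [disjoint Y1 & Y2] -> pairs X (Y1 :|: Y2) = pairs X Y1 + pairs X Y2.
Proof. by move=> d; rewrite !(pairsC X) pairs_Ul. Qed.

Lemma missing_sub X X' Y Y' :
  X \subset X' -> Y \subset Y' -> missing X Y <= missing X' Y'.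
Proof.
move=> sX sY; apply: (@leq_trans (missing X' Y)).
  rewrite !missing_sum [leqRHS](big_setID X) /= (setIidPr sX).
  exact: leq_addr.
rewrite missingC [leqRHS]missingC !missing_sum [leqRHS](big_setID Y) /=.
by rewrite (setIidPr sY); exact: leq_addr.
Qed.

Lemma missing_all X Y :
  (forall x y, x \in X -> y \in Y -> ~~ adj x y) -> missing X Y = #|X| * #|Y|.
Proof.
move=> h; rewrite -missingE /pairs big1 // => x xX.
by apply/eqP/deg_eq0 => y; apply: h.
Qed.

Lemma missing_ge X Y d :
  (forall x, x \in X -> d <= #|Y| - deg x Y) -> #|X| * d <= missing X Y.
Proof. by move=> h; rewrite missing_sum -sum_nat_const; apply: leq_sum. Qed.

Lemma missing0 X Y x y :
  missing X Y = 0 -> x \in X -> y \in Y -> adj x y.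
Proof.
rewrite missing_sum => /eqP; rewrite sum_nat_eq0 => /forallP /(_ x) h xX yY.
move: h; rewrite xX /= subn_eq0 => le.
have /eqP e : nbr x :&: Y == Y by rewrite eqEcard subsetIr.
by move: yY; rewrite -{1}e !inE => /andP[].
Qed.

Lemma pairs_setT_U (C P : {set G}) :
  [disjoint C & P] -> C :|: P = [set: G] ->
  pairs setT setT = pairs C C + 2 * pairs P C + pairs P P.
Proof.
move=> d <-; rewrite !(pairs_Ul, pairs_Ur) // (pairsC C P); lia.
Qed.

(** The adjacent ordered pairs are partitioned by their underlying edge, and each fibre is [(x, y)]
    with [(y, x)]. *)
Lemma handshake : 2 * #|edges G| = pairs setT setT.
Proof.
have ->: pairs setT setT = #|[set p : G * G | adj p.1 p.2]|.
  rewrite /pairs; under eq_bigr do rewrite degE.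
  rewrite pair_big -sum1_card [RHS]big_mkcond [LHS]big_mkcond /=.
  by apply: eq_bigr => -[x y] _; rewrite !inE /=; case: adj.
rewrite -[RHS]sum1_card (partition_big_imset (fun p : G * G => [set p.1; p.2])).
have <-: edges G = [set [set p.1; p.2] | p in [set p : G * G | adj p.1 p.2]].
  by apply/setP=> e; apply/imsetP/imsetP => -[p hp ->]; exists p => //;
    move: hp; rewrite !inE.
rewrite mulnC -sum_nat_const; apply: eq_bigr => e /imsetP[[x y]].
rewrite inE /= => xy ->; rewrite sum1dep_card.
have ne := adj_neq xy.
rewrite (_ : [set _ | _] = [set (x, y); (y, x)]).
  by rewrite cards2 xpair_eqE (negbTE ne).
apply/setP=> -[u v]; rewrite !inE !xpair_eqE /=.
apply/andP/orP => [[uv /eqP e2]|].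
  have: u \in [set x; y] by rewrite -e2 !inE eqxx.
  have: v \in [set x; y] by rewrite -e2 !inE eqxx orbT.
  move: (adj_neq uv); rewrite !inE => nuv.
  by do 2!case/orP=> /eqP ?; subst; rewrite ?eqxx in nuv *; auto.
case=> /andP[/eqP -> /eqP ->]; first by rewrite xy eqxx.
by rewrite adj_sym xy setUC eqxx.
Qed.

End Counting.

(** * Paths *)

Lemma card_pick (T : finType) (X Y : {set T}) :
  #|Y| < #|X| -> exists2 x, x \in X & x \notin Y.
Proof.
move=> h; have: 0 < #|X :\: Y| by rewrite cardsD;
  have := subset_leq_card (subsetIr X Y); lia.
by case/card_gt0P=> x; rewrite inE => /andP[? ?]; exists x.
Qed.

Section Paths.
Variable G : sgraph.
Implicit Types (x y v w : G) (X Y Z L : {set G}).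

(** [Z] collects the vertices already in use, which the whole path avoids, endpoints included. Paths
    built piece by piece thus stay simple. *)
Definition joined (l : nat) Z x y : Prop :=
  exists p : seq G,
    [/\ path (@adj G) x p, last x p = y, uniq (x :: p), size p = l
      & forall z, z \in x :: p -> z \notin Z].

Lemma joined0 Z x : x \notin Z -> joined 0 Z x x.
Proof. by move=> xZ; exists [::]; split=> // z; rewrite inE => /eqP->. Qed.

Lemma joined_cons l Z v x y :
  adj v x -> v \notin Z -> joined l (v |: Z) x y -> joined l.+1 Z v y.
Proof.
move=> vx vZ [p [pp lp up sp dp]]; exists (x :: p); split=> //=.
- by rewrite vx.
- rewrite -cons_uniq /= in up *; rewrite up andbT.
  by apply/negP => /dp; rewrite !inE eqxx.
- by rewrite sp.
move=> z; rewrite inE => /orP[/eqP->//|/dp].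
by rewrite inE negb_or => /andP[].
Qed.

Lemma joined_sym l Z x y : joined l Z x y -> joined l Z y x.
Proof.
move=> [p [pp <- up <- dp]]; exists (rev (belast x p)); split.
- by rewrite rev_path; under eq_path do rewrite adj_sym.
- by case: p {pp up dp} => [|a p] //=; rewrite rev_cons last_rcons.
- by rewrite -rev_rcons -lastI rev_uniq.
- by rewrite size_rev size_belast.
by move=> z; rewrite -rev_rcons -lastI mem_rev => /dp.
Qed.

Lemma joined_rcons l Z x y v :
  adj y v -> v \notin Z -> joined l (v |: Z) x y -> joined l.+1 Z x v.
Proof.
move=> yv vZ h; apply/joined_sym/(@joined_cons _ _ _ y) => //.
  by rewrite adj_sym.
exact: joined_sym.
Qed.

Lemma joined_cycle m l Z x y :
  cycle_free m G -> m = l.+1 -> joined l Z x y -> adj y x -> False.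
Proof.
move=> cf em [p [pp lp up sp dp]] yx; apply: cf; exists (x :: p).
by rewrite em /= sp; split=> //; rewrite /ucycle /= rcons_path pp lp yx.
Qed.

(** The path grows greedily at its head [x]. Since [x] is not its own neighbour, only the [l]
    vertices of [p] have to be avoided. *)
Lemma long_path X d l :
  X != set0 -> (forall x, x \in X -> d <= deg x X) -> l <= d ->
  exists x p, [/\ path (@adj G) x p, uniq (x :: p), size p = l
                & {subset x :: p <= X}].
Proof.
move=> /set0Pn[x0 x0X] h; elim: l => [_|l IHl ld].
  by exists x0, [::]; split=> // z; rewrite inE => /eqP->.
have [x [p [pp up sp dp]]] := IHl (ltnW ld).
have xX : x \in X by apply: dp; rewrite mem_head.
have [y] : exists2 y, y \in nbr x :&: X & y \notin [set z in p].
  apply: card_pick; apply: leq_trans (h x xX); apply: leq_trans ld.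
  by rewrite -sp ltnS cardsE card_size.
rewrite !inE => /andP[xy yX] yp; exists y, (x :: p); split.
- by rewrite /= adj_sym xy.
- by rewrite cons_uniq up inE (negbTE yp) eq_sym (negbTE (adj_neq xy)).
- by rewrite /= sp.
by move=> z; rewrite inE => /orP[/eqP->|/dp].
Qed.

(** A path on 2k vertices inside the neighbourhood of [v] closes through [v] to a cycle of length
    2k+1. Hence some vertex has degree at most 2k-2 in [X], and removing it loses at most 4k-4
    ordered pairs. *)
Lemma neighbourhood_sparse k v X :
  0 < k -> cycle_free (2 * k + 1) G -> X \subset nbr v ->
  pairs X X <= #|X| * (4 * k - 4).
Proof.
move=> k0 cf; move: {2}#|X| (leqnn #|X|) => m.
elim: m X => [|m IHm] X cX sX.
  have /eqP ->: X == set0 by rewrite -cards_eq0 -leqn0.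
  by rewrite /pairs big_set0.
have [->|X0] := eqVneq X set0; first by rewrite /pairs big_set0.
case: (boolP [forall x in X, 2 * k - 1 <= deg x X]) => [/forall_inP h|].
  have [x [p [pp up sp dp]]] := long_path X0 h (leqnn _).
  case: cf; exists (v :: x :: p); split; first by rewrite /= sp; lia.
  have inN z : z \in x :: p -> adj v z.
    by move=> /dp /(subsetP sX); rewrite inE.
  rewrite /ucycle cons_uniq up andbT; apply/andP; split.
    rewrite /cycle rcons_cons /= inN ?mem_head //= rcons_path pp /= adj_sym.
    by rewrite inN // mem_last.
  by apply/negP => /inN; rewrite adj_irr.
case/forall_inPn=> x xX; rewrite -ltnNge => dx.
rewrite -(setD1K xX) pairs_Ul; last by rewrite disjoints1 !inE eqxx.
have d1 : [disjoint [set x] & X :\ x] by rewrite disjoints1 !inE eqxx.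
rewrite !pairs_Ur // (pairsC _ [set x]) {1 2 3}/pairs !big_set1.
have -> : deg x [set x] = 0.
  by apply/eqP/deg_eq0 => y /set1P ->; rewrite adj_irr.
have IH : pairs (X :\ x) (X :\ x) <= #|X :\ x| * (4 * k - 4).
  apply: IHm; last by apply: subset_trans sX; apply: subD1set.
  by have := cardsD1 x X; rewrite xX; lia.
have := deg_sub x (subD1set X x).
by rewrite cardsU1 !inE eqxx /= mulnDl; lia.
Qed.

Definition linked (W : nat) L : Prop :=
  W <= #|L| /\
  forall x y, x \in L -> y \in L -> x != y -> W <= #|nbr x :&: nbr y|.

Lemma card_U1_le (T : finType) (a : T) (Z : {set T}) : #|a |: Z| <= #|Z|.+1.
Proof. by rewrite cardsU1; case: (_ \notin _). Qed.

(** Every second vertex is a fresh member of [L], and consecutive members are connected through a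
    fresh common neighbour. Each round puts two vertices into [Z] and shortens the path by two, so
    the bound on [#|Z|] is preserved. *)
Lemma linked_joined W L l Z x y :
  linked W L -> x \in L -> y \in L -> x != y -> x \notin Z -> y \notin Z ->
  #|Z| + 2 * l.+1 < W -> joined (2 * l.+1) Z x y.
Proof.
move=> [cL hL]; elim: l Z x => [|l IHl] Z x xL yL xy xZ yZ hW.
  have [b] : exists2 b, b \in nbr x :&: nbr y & b \notin Z.
    by apply: card_pick; apply: leq_trans (hL x y xL yL xy); lia.
  rewrite !inE => /andP[xb yb] bZ; rewrite muln1.
  apply: (@joined_cons _ _ _ b) => //; apply: (@joined_cons _ _ _ y).
  - by rewrite adj_sym.
  - by rewrite !inE negb_or bZ eq_sym (adj_neq xb).
  apply: joined0; rewrite !inE !negb_or yZ andbT.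
  by rewrite (adj_neq yb) eq_sym.
have [a aL] : exists2 a, a \in L & a \notin x |: (y |: Z).
  apply: card_pick; apply: leq_trans cL.
  have := card_U1_le x (y |: Z); have := card_U1_le y Z; move: hW; clear; lia.
rewrite !inE !negb_or => /and3P[ax ay aZ].
have [b] : exists2 b, b \in nbr x :&: nbr a & b \notin y |: Z.
  apply: card_pick; apply: leq_trans (hL x a xL aL _); last by rewrite eq_sym.
  by have := card_U1_le y Z; move: hW; clear; lia.
rewrite !inE !negb_or => /andP[xb ab] /andP[bY bZ].
rewrite mulnS add2n.
apply: (@joined_cons _ _ _ b) => //; apply: (@joined_cons _ _ _ a).
- by rewrite adj_sym.
- by rewrite !inE negb_or bZ eq_sym (adj_neq xb).
apply: IHl => //.
- by rewrite !inE !negb_or ax aZ (adj_neq ab).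
- by rewrite !inE !negb_or yZ andbT eq_sym bY eq_sym xy.
by have := card_U1_le b (x |: Z); have := card_U1_le x Z; move: hW; clear; lia.
Qed.

(** The endpoints need not lie in [L]: each first steps into [L]. Five neighbours suffice because
    the second choice has at most four vertices to avoid, namely [x], [b] and the two of [Z]. *)
Lemma linked_conn W L l Z x y :
  linked W L -> x != y -> x \notin Z -> y \notin Z ->
  #|Z| <= 2 -> 5 <= deg x L -> 5 <= deg y L ->
  2 * l.+1 + 5 <= W -> joined (2 * l.+1 + 2) Z x y.
Proof.
move=> hL xy xZ yZ cZ dx dy hW.
have [b] : exists2 b, b \in nbr x :&: L & b \notin y |: Z.
  by apply: card_pick; apply: leq_trans dx; have := card_U1_le y Z; move: cZ;
    clear; lia.
rewrite !inE !negb_or => /andP[xb bL] /andP[bY bZ].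
have [c] : exists2 c, c \in nbr y :&: L & c \notin x |: (b |: Z).
  apply: card_pick; apply: leq_trans dy.
  have := card_U1_le x (b |: Z); have := card_U1_le b Z; move: cZ; clear.
  by lia.
rewrite !inE !negb_or => /andP[yc cL] /and3P[cx cb cz].
rewrite addn2; apply: (@joined_cons _ _ _ b) => //.
apply: (@joined_rcons _ _ _ c).
- by rewrite adj_sym.
- by rewrite !inE negb_or yZ eq_sym xy.
apply: (linked_joined hL) => //.
- by rewrite eq_sym.
- by rewrite !inE !negb_or bZ bY eq_sym (adj_neq xb).
- by rewrite !inE !negb_or cz cx eq_sym (adj_neq yc).
have := card_U1_le y (x |: Z); have := card_U1_le x Z; move: cZ hW; clear.
by lia.
Qed.

End Paths.

(** * The core spanned by two linked sets *)

Section Core.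
Variable G : sgraph.
Implicit Types (x y v w : G) (X Y Z L : {set G}).

Definition attached (t : nat) L : {set G} := [set v | t <= deg v L].

Lemma notin_set0 x : x \notin (set0 : {set G}).
Proof. by rewrite inE. Qed.

Variables (k W t : nat) (LA LB : {set G}).
Hypotheses (k2 : 2 <= k) (cf : cycle_free (2 * k + 1) G).
Hypotheses (WK : 2 * k + 6 <= W) (t5 : 5 <= t).

(** The ends of an edge would also be joined by a path of length 2k through [L]. *)
Lemma attached_indep L x y :
  linked W L -> x \in attached t L -> y \in attached t L -> ~~ adj x y.
Proof.
move=> hL; rewrite !inE => dx dy; apply/negP => xy.
have h : joined (2 * (k - 2).+1 + 2) set0 x y.
  apply: (linked_conn hL); rewrite ?inE ?cards0 ?(adj_neq xy) //.
  - exact: leq_trans t5 dx.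
  - exact: leq_trans t5 dy.
  by move: k2 WK; clear; lia.
apply: (joined_cycle cf _ h); last by rewrite adj_sym.
by move: k2; clear; lia.
Qed.

Hypotheses (hLA : linked W LA) (hLB : linked W LB).
Hypotheses (sLA : LA \subset attached t LB) (sLB : LB \subset attached t LA).
Local Notation A := (attached t LB).
Local Notation B := (attached t LA).

(** A vertex [v] in both sets has neighbours [a] in [LA] and [b] in [LB], and [a] has a neighbour
    [c] in [LB]. A path of length 2k-2 from [c] to [b] closes to a cycle of length 2k+1. *)
Lemma attached_disjoint : [disjoint A & B].
Proof.
rewrite disjoint_subset; apply/subsetP => v; rewrite !inE => vB.
apply/negP => vA.
have [a] : exists2 a, a \in nbr v :&: LA & a \notin (set0 : {set G}).
  by apply: card_pick; rewrite cards0; apply: leq_trans vA; move: t5; case: t.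
rewrite !inE => /andP[va /[dup] aL /(subsetP sLA)]; rewrite inE => da _.
have [b] : exists2 b, b \in nbr v :&: LB & b \notin [set a].
  by apply: card_pick; rewrite cards1; apply: leq_trans vB; move: t5; clear;
    lia.
rewrite !inE => /andP[vb bL] ba.
have [c] : exists2 c, c \in nbr a :&: LB & c \notin [set b; v].
  apply: card_pick; rewrite cards2; apply: leq_trans da.
  by move: t5; clear; case: (_ != _); lia.
rewrite !inE negb_or => /andP[ac cL] /andP[cb cv].
have h : joined (2 * (k - 2).+1) (a |: (v |: set0)) c b.
  apply: (linked_joined hLB) => //.
  - by rewrite !inE orbF negb_or cv eq_sym (adj_neq ac).
  - by rewrite !inE orbF negb_or ba eq_sym (adj_neq vb).
  rewrite setU0 cards2; move: WK k2; clear; case: (_ != _); lia.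
have h2 : joined (2 * (k - 2).+1).+1 (v |: set0) a b.
  apply: (joined_cons ac) h.
  by rewrite !inE orbF eq_sym (adj_neq va).
apply: (joined_cycle cf _ (joined_cons va (notin_set0 v) h2)).
  by move: k2; clear; lia.
by rewrite adj_sym.
Qed.

(** For k at least 3, one step from [x] into [LB] followed by [linked_conn] gives length 2k-1. For k
    = 2 the length is 3, too short for that; an edge between the neighbourhoods of [x] and [y] is
    needed, and its absence would make at least (t-2)^2 pairs missing. *)
Lemma joined_opposite x y u :
  (k = 2 -> missing A B < (t - 2) ^ 2) ->
  x \in A -> y \in B -> x != u -> y != u -> joined (2 * k - 1) [set u] x y.
Proof.
move=> hk xA yB xu yu.
have dx : t <= deg x LB by move: xA; rewrite inE.
have dy : t <= deg y LA by move: yB; rewrite inE.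
have xy : x != y.
  by apply: contraTneq yB => <-; rewrite (disjointFr attached_disjoint).
have [k3|k3] := leqP 3 k.
  have [b] : exists2 b, b \in nbr x :&: LB & b \notin [set y; u].
    apply: card_pick; rewrite cards2; apply: leq_trans dx.
    by move: t5; clear; case: (_ != _); lia.
  rewrite !inE negb_or => /andP[xb bL] /andP[yb ub].
  have -> : 2 * k - 1 = (2 * (k - 3).+1 + 2).+1 by move: k3; clear; lia.
  apply: (joined_cons xb); first by rewrite inE.
  apply: (linked_conn hLA) => //.
  - by rewrite !inE negb_or ub eq_sym (adj_neq xb).
  - by rewrite !inE negb_or yu eq_sym xy.
  - by rewrite cards2; case: (_ != _).
  - by apply: leq_trans t5 _; move/(subsetP sLB): bL; rewrite inE.
  - exact: leq_trans t5 dy.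
  by move: WK k3; clear; lia.
have {k3}ek : k = 2 by apply/eqP; rewrite eqn_leq k2 -ltnS k3.
rewrite ek; set X := (nbr x :&: LB) :\: [set y; u].
set Y := (nbr y :&: LA) :\: [set x; u].
have cD (S T : {set G}) (a b : G) : t <= #|S| -> t - 2 <= #|S :\: [set a; b]|.
  move=> h; rewrite cardsD; have := subset_leq_card (subsetIr S [set a; b]).
  by rewrite cards2; move: h; clear; case: (_ != _); lia.
case: (boolP [exists b in X, exists a in Y, adj b a]) => [|/exists_inPn h].
  case/exists_inP => b; rewrite /X !inE negb_or -!andbA => /and4P[yb ub xb bL].
  case/exists_inP => a;
    rewrite /Y !inE negb_or -!andbA => /and4P[xa ua ya aL] ba.
  apply: (joined_cons xb); first by rewrite inE.
  apply: (joined_cons ba).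
    by rewrite !inE negb_or ub eq_sym (adj_neq xb).
  apply: (@joined_cons _ _ _ _ y); first by rewrite adj_sym.
    by rewrite !inE !negb_or xa ua eq_sym (adj_neq ba).
  apply: joined0; rewrite !inE !negb_or yu (adj_neq ya) eq_sym yb.
  by rewrite eq_sym xy.
have := hk ek; rewrite ltnNge => /negP; case.
rewrite missingC; apply: leq_trans (missing_sub (X := X) (Y := Y) _ _).
- rewrite missing_all; last first.
    by move=> b a /h /exists_inPn nb /nb.
  by rewrite -mulnn leq_mul ?cD.
- apply: subset_trans sLB; apply: subset_trans (subsetDl _ _) _.
  exact: subsetIr.
- apply: subset_trans sLA; apply: subset_trans (subsetDl _ _) _.
  exact: subsetIr.
Qed.

Lemma one_sided u x y :
  (k = 2 -> missing A B < (t - 2) ^ 2) ->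
  x \in A -> y \in B -> adj u x -> ~~ adj u y.
Proof.
move=> hk xA yB ux; apply/negP => uy.
have h : joined (2 * k - 1) (u |: set0) x y.
  rewrite setU0; apply: joined_opposite => //.
    by rewrite eq_sym (adj_neq ux).
  by rewrite eq_sym (adj_neq uy).
apply: (joined_cycle cf _ (joined_cons ux (notin_set0 u) h)).
  by move: k2; clear; lia.
by rewrite adj_sym.
Qed.

(** Distinct [x] and [y] would be joined by a path of length 2k-2 avoiding [u] and [v], closed by
    the three edges through [u] and [v]. For k = 2 this path is just a common neighbour, supplied by
    the hypothesis. *)
Lemma same_attachment u v x y :
  (k = 2 -> exists2 z, z \in B & adj x z && adj y z) ->
  u \notin A :|: B -> v \notin A :|: B -> x \in A -> y \in A ->
  adj u v -> adj u x -> adj v y -> x = y.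
Proof.
move=> hk; rewrite !in_setU !negb_or => /andP[uA uB] /andP[vA vB] xA yA.
move=> uv ux vy; apply/eqP; case: eqVneq => // xy.
have neq (z z' : G) (S : {set G}) : z \in S -> z' \notin S -> z != z'.
  by move=> zS; apply: contraNneq => <-.
have h : joined (2 * k - 2) (u |: (v |: set0)) x y.
  rewrite setU0; have [k3|k3] := leqP 3 k.
    have -> : 2 * k - 2 = 2 * (k - 3).+1 + 2 by move: k3; clear; lia.
    apply: (linked_conn hLB) => //.
    - by rewrite !inE negb_or !(neq _ _ A).
    - by rewrite !inE negb_or !(neq _ _ A).
    - by rewrite cards2; case: (_ != _).
    - by apply: leq_trans t5 _; move: xA; rewrite inE.
    - by apply: leq_trans t5 _; move: yA; rewrite inE.
    by move: WK k3; clear; lia.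
  have {k3}ek : k = 2 by apply/eqP; rewrite eqn_leq k2 -ltnS k3.
  have [z zB /andP[xz yz]] := hk ek; rewrite ek.
  apply: (joined_cons xz); first by rewrite !inE negb_or !(neq _ _ A).
  apply: (@joined_cons _ _ _ _ y); first by rewrite adj_sym.
    by rewrite !inE !negb_or (neq z u B) // (neq z v B) // andbT eq_sym (adj_neq xz).
  by apply: joined0;
    rewrite !inE !negb_or (neq y u A) // (neq y v A) // (adj_neq yz) eq_sym xy.
have h2 : joined (2 * k - 2).+1 (v |: set0) u y.
  apply: (joined_cons ux) h.
  by rewrite !inE orbF (adj_neq uv).
have h3 : joined (2 * k - 2).+2 set0 u v.
  by apply: (joined_rcons _ (notin_set0 v) h2); rewrite adj_sym.
case: (joined_cycle cf _ h3); last by rewrite adj_sym.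
by move: k2; clear; lia.
Qed.

End Core.

(** * Refining a bipartition *)

Section Dense.
Variable G : sgraph.
Implicit Types (x y v w : G) (X Y Z L : {set G}).

Definition dense (W : nat) Y : {set G} := [set v | W + #|Y| <= 2 * deg v Y].

(** By inclusion-exclusion in [Y], two neighbourhoods of total size at least [W + #|Y|] meet in at
    least [W] vertices. *)
Lemma dense_linked W Y : W <= #|dense W Y| -> linked W (dense W Y).
Proof.
move=> cW; split=> // x y; rewrite !inE => dx dy _.
apply: (@leq_trans #|(nbr x :&: Y) :&: (nbr y :&: Y)|).
  have := cardsUI (nbr x :&: Y) (nbr y :&: Y).
  have : #|(nbr x :&: Y) :|: (nbr y :&: Y)| <= #|Y|.
    by rewrite -setIUl subset_leq_card ?subsetIr.
  move: dx dy; rewrite /deg; clear; lia.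
by rewrite subset_leq_card ?setISS ?subsetIl.
Qed.

(** A vertex that is not dense misses more than half of [#|Y| - W] vertices of [Y]. *)
Lemma dense_exceptions W X Y :
  #|X :\: dense W Y| * (#|Y| - W) <= 2 * missing X Y.
Proof.
apply: (@leq_trans (2 * missing (X :\: dense W Y) Y)); last first.
  by rewrite leq_mul2l missing_sub ?subsetDl.
rewrite missing_sum big_distrr -sum_nat_const /=; apply: leq_sum => x.
by rewrite !inE => /andP[+ _]; have := deg_le x Y; clear; lia.
Qed.

Lemma deg_codense x Y Y' : deg x Y <= deg x Y' + #|Y :\: Y'|.
Proof. by rewrite (deg_ID x Y Y') leq_add ?deg_le ?deg_sub ?subsetIr. Qed.

Lemma dense_attached W t Y L :
  2 * t + 2 * #|Y :\: L| <= W + #|Y| -> dense W Y \subset attached t L.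
Proof.
move=> h; apply/subsetP => x; rewrite !inE.
by have := deg_codense x Y L; move: h; clear; lia.
Qed.

End Dense.

(** The vertices of [A1] that are not dense to [B1], and conversely, are the exceptions. The two
    [card] fields make the dense sets large enough to be linked; the two [att] fields put each dense
    set inside the attached set of its own side. *)
Record refinable (G : sgraph) (k W t : nat) (A1 B1 : {set G}) : Prop :=
  Refinable {
    refinable_k : 2 <= k;
    refinable_free : cycle_free (2 * k + 1) G;
    refinable_W : 2 * k + 6 <= W;
    refinable_t : 5 <= t;
    refinable_cardA : W + #|A1 :\: dense W B1| <= #|A1|;
    refinable_cardB : W + #|B1 :\: dense W A1| <= #|B1|;
    refinable_attA : 2 * t + 2 * #|A1 :\: dense W B1| <= W + #|A1|;
    refinable_attB : 2 * t + 2 * #|B1 :\: dense W A1| <= W + #|B1|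
  }.

Section Refine.
Variables (G : sgraph) (k W t : nat) (A1 B1 : {set G}).
Local Notation LA := (dense W B1).
Local Notation LB := (dense W A1).
Local Notation A := (attached t LB).
Local Notation B := (attached t LA).
Local Notation P := (~: (A :|: B)).
Local Notation q := (#|A :\: LA| + #|B :\: LB|).
Hypothesis H : refinable k W t A1 B1.
Let k2 := refinable_k H.
Let cf := refinable_free H.
Let WK := refinable_W H.
Let t5 := refinable_t H.

Lemma refine_linkedA : linked W LA.
Proof.
apply: dense_linked; have := subset_leq_card (subsetIr A1 LA).
by have := refinable_cardA H; rewrite cardsD; clear; lia.
Qed.

Lemma refine_linkedB : linked W LB.
Proof.
apply: dense_linked; have := subset_leq_card (subsetIr B1 LB).
by have := refinable_cardB H; rewrite cardsD; clear; lia.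
Qed.

Lemma refine_subA : LA \subset A.
Proof. exact: dense_attached (refinable_attB H). Qed.

Lemma refine_subB : LB \subset B.
Proof. exact: dense_attached (refinable_attA H). Qed.

Lemma refine_disjoint : [disjoint A & B].
Proof.
exact: (attached_disjoint k2 cf WK t5 refine_linkedB refine_subA).
Qed.

Lemma refine_card : #|A| + #|B| + #|P| = #|G|.
Proof.
rewrite -(cardsC (A :|: B)) cardsU.
have /eqP -> : #|A :&: B| == 0 by rewrite cards_eq0 setI_eq0 refine_disjoint.
by rewrite subn0.
Qed.

(** The new side [A] contains all of [A1] but its exceptions, and likewise for [B]. When [A1] and
    [B1] cover the graph, the outside vertices and the [q] non-dense vertices of [A] and [B]
    together are no more than the exceptions. *)
Lemma refine_outside :
  [disjoint A1 & B1] ->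
  #|P| + q + (#|A1| + #|B1|) <= #|G| + (#|A1 :\: LA| + #|B1 :\: LB|).
Proof.
move=> d1; have := refine_card.
have := cardsID LA A; rewrite (setIidPr refine_subA).
have := cardsID LB B; rewrite (setIidPr refine_subB).
have := cardsID LA A1; have := cardsID LB B1.
have := subset_leq_card (subsetIr A1 LA).
have := subset_leq_card (subsetIr B1 LB).
clear; lia.
Qed.

Lemma refine_degA u : u \in P -> deg u A <= t.-1 + #|A :\: LA|.
Proof.
rewrite !inE negb_or -!ltnNge => /andP[_ h].
by apply: leq_trans (deg_codense u A LA) _; rewrite leq_add2r; case: t h.
Qed.

Lemma refine_degB u : u \in P -> deg u B <= t.-1 + #|B :\: LB|.
Proof.
rewrite !inE negb_or -!ltnNge => /andP[h _].
by apply: leq_trans (deg_codense u B LB) _; rewrite leq_add2r; case: t h.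
Qed.

Lemma refine_indepA x y : x \in A -> y \in A -> ~~ adj x y.
Proof. exact: (attached_indep k2 cf WK t5 refine_linkedB). Qed.

Lemma refine_indepB x y : x \in B -> y \in B -> ~~ adj x y.
Proof. exact: (attached_indep k2 cf WK t5 refine_linkedA). Qed.

Lemma refine_edges :
  2 * #|edges G| = 2 * pairs A B + 2 * pairs P (A :|: B) + pairs P P.
Proof.
rewrite handshake (@pairs_setT_U _ (A :|: B) P); last exact: setUCr.
  rewrite pairs_Ul ?refine_disjoint // !pairs_Ur ?refine_disjoint //.
  have -> : pairs A A = 0.
    by rewrite /pairs big1 // => x xA; apply/eqP/deg_eq0 => y;
      apply: refine_indepA.
  have -> : pairs B B = 0.
    by rewrite /pairs big1 // => x xA; apply/eqP/deg_eq0 => y;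
      apply: refine_indepB.
  by rewrite (pairsC B A); clear; lia.
by rewrite -setI_eq0 setICr.
Qed.

Lemma refine_edges_le :
  2 * #|edges G| <= 2 * pairs A B + 2 * #|P| * (2 * t + q) + #|P| ^ 2.
Proof.
rewrite refine_edges -mulnn.
have := @pairs_const _ P P #|P| (fun x _ => deg_le x P).
have : pairs P (A :|: B) <= #|P| * (2 * t + q).
  apply: pairs_const => u uP; apply: leq_trans (deg_U _ _ _) _.
  by have := refine_degA uP; have := refine_degB uP; clear; lia.
by rewrite -mulnA; clear; lia.
Qed.

Lemma refine_missA x :
  x \in A :\: LA -> #|B1| <= W + 2 * #|B1 :\: LB| + 2 * (#|B| - deg x B).
Proof.
rewrite inE => /andP[+ _]; rewrite inE -ltnNge => h.
have e1 := deg_ID x B B1; have := deg_sub x (subsetIr B B1).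
have := deg_le x (B :\: B1); have := cardsID B1 B; have := cardsID LB B1.
have : #|B1 :&: LB| <= #|B :&: B1|.
  by rewrite setIC subset_leq_card ?setSI ?refine_subB.
move: h e1; clear; lia.
Qed.

Lemma refine_missB x :
  x \in B :\: LB -> #|A1| <= W + 2 * #|A1 :\: LA| + 2 * (#|A| - deg x A).
Proof.
rewrite inE => /andP[+ _]; rewrite inE -ltnNge => h.
have e1 := deg_ID x A A1; have := deg_sub x (subsetIr A A1).
have := deg_le x (A :\: A1); have := cardsID A1 A; have := cardsID LA A1.
have : #|A1 :&: LA| <= #|A :&: A1|.
  by rewrite setIC subset_leq_card ?setSI ?refine_subA.
move: h e1; clear; lia.
Qed.

Lemma refine_missing d :
  W + 2 * #|A1 :\: LA| + 2 * d <= #|A1| ->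
  W + 2 * #|B1 :\: LB| + 2 * d <= #|B1| ->
  q * d <= 2 * missing A B.
Proof.
move=> hA hB; rewrite mulnDl mul2n -addnn leq_add //.
  apply: leq_trans (missing_sub (subsetDl A LA) (subxx B)).
  apply: missing_ge => x /refine_missA; move: hB; clear; lia.
rewrite missingC; apply: leq_trans (missing_sub (subsetDl B LB) (subxx A)).
by apply: missing_ge => x /refine_missB; move: hA; clear; lia.
Qed.

End Refine.

(** * Numerical bounds and the initial bipartition *)

Lemma mul2_bin2 n : 2 * 'C(n, 2) = n * n.-1.
Proof. by rewrite -(mul_bin_diag n 1) bin1. Qed.

(** The square is expanded around n. The terms in r alone absorb the loss of at most 3 caused by the
    floor. *)
Lemma edge_bound n r e : 3 <= r <= n ->
  (n - r + 1) ^ 2 %/ 4 + 'C(r, 2) <= e -> n ^ 2 <= 4 * e + 2 * (r.-1 * n).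
Proof.
move=> /andP[r3 rn]; have := mul2_bin2 r.
have := divn_eq ((n - r + 1) ^ 2) 4.
have : (n - r + 1) ^ 2 %% 4 < 4 by rewrite ltn_mod.
have [s er] : exists s, r = s.+3 by exists (r - 3); lia.
have [m en] : exists m, n = m + s.+3 by exists (n - r); lia.
rewrite er en (_ : m + s.+3 - s.+3 + 1 = m.+1) /=; last lia.
move: (_ %/ _) (_ %% _) 'C(_, _) => x y z; rewrite -!mulnn.
clear; nia.
Qed.

(** These three consequences are the form in which the lower bound on [n] enters all later
    estimates. *)
Lemma order_bounds n k r : 2 <= k -> 3 <= r <= 2 * k ->
  2 * (r + 2) * (r + 1) * (r + 2 * k) <= n ->
  [/\ 40 * (2 * k + r) <= n, 140 * r.-1 <= n
    & 4 * (r * (r + 1) * (r + 2)) <= n].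
Proof.
move=> k2 /andP[r3 rk] hn.
have h1 : 20 <= (r + 2) * (r + 1).
  by apply: (@leq_mul 5 4); move: r3; clear; lia.
have h3 : 4 * (r * (r + 1) * (r + 2)) <= n.
  apply: leq_trans hn; have : r + r <= r + 2 * k by rewrite leq_add2l.
  by move: (r + 2 * k) => x; clear; nia.
have h2 : 40 * (2 * k + r) <= n.
  by apply: leq_trans hn; rewrite (addnC (2 * k)); move: h1; clear; nia.
split=> //; have [r4|r4] := leqP 4 r.
  apply: leq_trans h3; have -> : r = (r - 4) + 4 by move: r4; clear; lia.
  by move: (r - 4) => s; rewrite addnS /=; clear; nia.
by apply: leq_trans h2; move: r3 r4 k2; clear; lia.
Qed.

(** Applied with y = 2(k-1), R = r-1 and with c, c+s the numbers b and a+2(k-1) in increasing order,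
    whose sum is n+y. Writing 4c(c+s) as (n+y)^2 - s^2 leaves 2M + s^2 at most 2xn + y^2, which is
    small because x is at most n/40. *)
Lemma balance_bound M n x y c s R :
  y + R = x -> 40 * x <= n -> n + y = 2 * c + s ->
  2 * M + n ^ 2 <= 4 * (c * (c + s)) + 2 * (R * n) ->
  40 * s <= 9 * n /\ 39 * M <= n ^ 2.
Proof.
move=> xE xn ny h.
have e : 4 * (c * (c + s)) + s ^ 2 = (n + y) ^ 2 by rewrite ny; clear; lia.
have h1 : 2 * M + s ^ 2 <= 2 * (x * n) + y ^ 2.
  by move: h e; rewrite -xE; clear; lia.
have h2 : 40 * (x * n) <= n ^ 2 by rewrite mulnA -mulnn leq_mul2r xn orbT.
have h3 : 1600 * y ^ 2 <= n ^ 2.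
  have -> : 1600 * y ^ 2 = (40 * y) ^ 2 by rewrite expnMn.
  by rewrite leq_sqr; move: xE xn; clear; lia.
split; last by move: h1 h2 h3; clear; lia.
rewrite -leq_sqr !expnMn; move: h1 h2 h3; clear; lia.
Qed.

(* The witness for [B] is the neighbourhood of a vertex of maximum degree. *)
Lemma max_degree_bipartition (G : sgraph) n k r :
  #|G| = n -> 2 <= k -> 3 <= r <= 2 * k ->
  40 * (2 * k + r) <= n -> cycle_free (2 * k + 1) G ->
  n ^ 2 <= 4 * #|edges G| + 2 * (r.-1 * n) ->
  exists A B : {set G},
    [/\ [disjoint A & B], #|A| + #|B| = n, 37 * n <= 100 * #|A|,
        37 * n <= 100 * #|B| & 39 * missing A B <= n ^ 2].
Proof.
move=> cG k2 hr hn cf he.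
have [u _] : exists u : G, u \in [set: G].
  by apply/set0Pn; rewrite -cards_eq0 cardsT cG -lt0n; move: hn k2; clear; lia.
case: (@arg_maxnP _ u predT (fun v => #|nbr v|) isT) => {}u _ umax.
set B := nbr u; set A := ~: B.
have dAB : [disjoint A & B] by rewrite -setI_eq0 setIC setICr.
have cAB : #|A| + #|B| = n by rewrite addnC cardsC.
exists A, B.
have hs : 2 * #|edges G| = pairs B B + 2 * pairs A B + pairs A A.
  by rewrite handshake (@pairs_setT_U _ B A) ?setUCr // disjoint_sym.
have hB : pairs B B <= #|B| * (4 * k - 4).
  by apply: (neighbourhood_sparse (v := u)) => //; exact: ltnW.
(* No degree exceeds the maximum degree [#|B|]. *)
have hA : pairs A A + pairs A B <= #|A| * #|B|.
  rewrite -pairs_Ur // setUC setUCr; apply: pairs_const => x _.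
  by rewrite /deg setIT; apply: umax.
have hM := missingE A B.
move: (missing A B) (pairs _ _) (pairs _ _) (pairs _ _) hs hB hA hM he.
move=> M bb ab aa hs hB hA hM he.
have key : 2 * M + n ^ 2 <=
    4 * (#|A| * #|B|) + 8 * (#|B| * k.-1) + 2 * (r.-1 * n).
  have e4 : #|B| * (4 * k - 4) = 4 * (#|B| * k.-1).
    by rewrite mulnCA; congr (_ * _); move: k2; clear; lia.
  by move: he hs hB hA hM; rewrite e4; clear; lia.
have hx : 40 * (2 * k.-1 + r.-1) <= n by move: hn; clear; lia.
(* The cost of the edges inside [B] is absorbed by enlarging the factor [#|A|] by 2(k-1), which
   leaves a single product. *)
have keyD : 2 * M + n ^ 2 <=
    4 * (#|B| * (#|A| + 2 * k.-1)) + 2 * (r.-1 * n).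
  by move: key; clear; lia.
move: (#|A|) (#|B|) cAB keyD {key hA hB hM hs} => a b cAB keyD.
split=> //.
- have [le|/ltnW le] := leqP b (a + 2 * k.-1); first by move: hx hn cAB le;
    clear; lia.
  have [||+ _] := @balance_bound M n _ (2 * k.-1) (a + 2 * k.-1)
    (b - (a + 2 * k.-1)) _ erefl hx.
  + by move: cAB le; clear; lia.
  + by rewrite subnKC // (mulnC (a + _)).
  by move: le cAB hx; clear; lia.
- have [le|le] := leqP b (a + 2 * k.-1); last by move: cAB le; clear; lia.
  have [||+ _] := @balance_bound M n _ (2 * k.-1) b
    (a + 2 * k.-1 - b) _ erefl hx.
  + by move: cAB le; clear; lia.
  + by rewrite subnKC.
  by move: le cAB; clear; lia.
have [le|/ltnW le] := leqP b (a + 2 * k.-1).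
  have [||//] := @balance_bound M n _ (2 * k.-1) b
    (a + 2 * k.-1 - b) _ erefl hx.
  + by move: cAB le; clear; lia.
  + by rewrite subnKC.
have [||//] := @balance_bound M n _ (2 * k.-1) (a + 2 * k.-1)
  (b - (a + 2 * k.-1)) _ erefl hx.
+ by move: cAB le; clear; lia.
+ by rewrite subnKC // (mulnC (a + _)).
Qed.

(** * The two refinement steps *)

Section Steps.
Variables (G : sgraph) (n k r : nat).
Hypotheses (cG : #|G| = n) (k2 : 2 <= k) (hr : 3 <= r <= 2 * k).
Hypothesis cf : cycle_free (2 * k + 1) G.
Hypothesis he : n ^ 2 <= 4 * #|edges G| + 2 * (r.-1 * n).
Hypotheses (hn1 : 40 * (2 * k + r) <= n) (hn2 : 140 * r.-1 <= n).
Local Notation W := (2 * k + 6).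

Section Balance.
Variables (t : nat) (A1 B1 : {set G}).
Local Notation LA := (dense W B1).
Local Notation LB := (dense W A1).
Local Notation A := (attached t LB).
Local Notation B := (attached t LA).
Local Notation P := (~: (A :|: B)).
Local Notation q := (#|A :\: LA| + #|B :\: LB|).
Hypothesis H : refinable k W t A1 B1.

(** With sides a, b, outside size p and M missing pairs, this says 4M + (a-b)^2 + 2pn is at most
    2(r-1)n + p(8t+4q+3p), written without subtraction. It controls missing pairs, imbalance and
    outside vertices at once. *)
Lemma refine_balance :
  4 * missing A B + (#|A| ^ 2 + #|B| ^ 2) + 2 * (#|P| * n)
  <= 2 * (r.-1 * n) + 2 * (#|A| * #|B|) + #|P| * (8 * t + 4 * q + 3 * #|P|).
Proof.
have h := refine_edges_le H.
have hc := refine_card H.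
have hM := missingE A B.
rewrite cG in hc; move: he h hc hM.
move: #|P| #|A| #|B| (missing A B) (pairs A B) q #|edges G| (r.-1 * n).
clear=> p a b M X q e R + h + hM => + hn; rewrite -{}hn => he.
have e1 : (a + b + p) ^ 2 =
  a ^ 2 + b ^ 2 + p ^ 2 + 2 * (a * b) + 2 * (p * a) + 2 * (p * b) by lia.
move: he h hM; rewrite e1; lia.
Qed.

End Balance.

(** The threshold is 5, the least that [refinable] admits. There are at most 31n/200 exceptions on
    each side, so the error p(8t+4q+3p) is at most 1.39pn and leaves 0.61pn of the term 2pn. *)
Lemma first_refinement : exists A B : {set G},
  [disjoint A & B] /\ exists p, #|A| + #|B| + p = n /\
  400 * missing A B + 100 * (#|A| ^ 2 + #|B| ^ 2) + 61 * (p * n)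
  <= 200 * (r.-1 * n) + 200 * (#|A| * #|B|).
Proof.
have [A1 [B1 [d1 c1 hA1 hB1 hM]]] := max_degree_bipartition cG k2 hr hn1 cf he.
have hW : 28 * W <= n by move: hn1 hr k2; clear; lia.
have n280 : 280 <= n by move: hn1 hr k2; clear; lia.
have bound x y M : 37 * n <= 100 * y -> x * (y - W) <= 2 * M ->
    39 * M <= n ^ 2 -> 200 * x <= 31 * n.
  move=> hy hx hM'; rewrite leqNgt; apply/negP => gt.
  have h1 : 1000 * (y - W) >= 334 * n by move: hW hy; clear; lia.
  have : (31 * n) * (334 * n) <= (200 * x) * (1000 * (y - W)).
    by apply: leq_mul => //; exact: ltnW.
  have n0 : 0 < n ^ 2 by rewrite expn_gt0; apply/orP; left; move: n280; clear;
    lia.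
  by move: hx hM' n0; rewrite -!mulnn; clear; lia.
have bA := bound _ _ _ hB1 (dense_exceptions W A1 B1) hM.
have bB : 200 * #|B1 :\: dense W A1| <= 31 * n.
  by apply: bound hA1 (dense_exceptions W B1 A1) _; rewrite missingC.
have cA : W + #|A1 :\: dense W B1| <= #|A1| by move: hA1 bA hW; clear; lia.
have cB : W + #|B1 :\: dense W A1| <= #|B1| by move: hB1 bB hW; clear; lia.
have tA : 2 * 5 + 2 * #|A1 :\: dense W B1| <= W + #|A1|.
  by move: hA1 bA n280; clear; lia.
have tB : 2 * 5 + 2 * #|B1 :\: dense W A1| <= W + #|B1|.
  by move: hB1 bB n280; clear; lia.
have H := Refinable k2 cf (leqnn W) (leqnn 5) cA cB tA tB.
have h := refine_balance H.
have hd := refine_disjoint H.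
have hc := refine_card H.
have ho := refine_outside H d1.
move: hd hc ho h.
set A := attached 5 (dense W A1);
  set B := attached 5 (dense W B1) => hd hc ho h.
exists A, B; split=> //; exists #|~: (A :|: B)|; split; first by rewrite hc.
move: h ho; move: #|~: _| (_ + #|_ :\: _|) => p q h ho.
have coef : 100 * (8 * 5 + 4 * q + 3 * p) + 61 * n <= 200 * n.
  by move: ho bA bB n280 c1; rewrite cG; clear; lia.
have {}coef := leq_mul (leqnn p) coef.
by move: h coef; rewrite mulnDr; clear; lia.
Qed.

(** Here (a-b)^2 is at most 2(r-1)n, hence at most n^2/70, which is below (0.12n)^2. *)
Lemma sides_balanced a b : a ^ 2 + b ^ 2 <= 2 * (r.-1 * n) + 2 * (a * b) ->
  100 * a <= 100 * b + 12 * n.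
Proof.
move=> h; rewrite leqNgt; apply/negP => gt.
have [s es] : exists s, a = b + s by exists (a - b); move: gt; clear; lia.
have h1 : s ^ 2 <= 2 * (r.-1 * n) by move: h; rewrite es; clear; lia.
have h2 : 140 * (r.-1 * n) <= n * n by rewrite mulnA leq_mul2r hn2 orbT.
have h3 : (12 * n) ^ 2 < (100 * s) ^ 2.
  by rewrite ltn_sqr; move: gt; rewrite es; clear; lia.
by move: h1 h2 h3; rewrite !expnMn; clear; lia.
Qed.

Hypothesis hn3 : 4 * (r * (r + 1) * (r + 2)) <= n.
Local Notation t := (n %/ (4 * r)).

(** The threshold n/(4r) is a compromise: r vertices with fewer than [t] neighbours each account for
    at most n/4 edges, while for k = 2 the square of t-2 must exceed the number of missing pairs. *)
Lemma second_refinement : exists A1 B1 : {set G}, refinable k W t A1 B1 /\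
  let LA := dense W B1 in let LB := dense W A1 in
  let A := attached t LB in let B := attached t LA in
  let p := #|~: (A :|: B)| in let q := #|A :\: LA| + #|B :\: LB| in
  [/\ p <= 2 * r.-1, 2 * missing A B <= r.-1 * n, 4 * (p * q) <= missing A B,
      43 * n <= 100 * #|A| & 43 * n <= 100 * #|B|].
Proof.
have [A1 [B1 [d1 [p1 [c1 h1]]]]] := first_refinement.
have hW : 28 * W <= n by move: hn1 hr k2; clear; lia.
have n280 : 280 <= n by move: hn1 hr k2; clear; lia.
have n0 : 0 < n by apply: leq_trans n280.
have r3 : 3 <= r by case/andP: hr.
have sides a b X : 100 * (a ^ 2 + b ^ 2) + X <= 200 * (r.-1 * n) + 200 * (a * b) ->
    100 * a <= 100 * b + 12 * n /\ 100 * b <= 100 * a + 12 * n.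
  by move=> h; split; apply: sides_balanced; move: h; clear; lia.
have hp1 : 61 * p1 <= 200 * r.-1.
  rewrite -(leq_pmul2r n0) -!mulnA.
  have := (nat_Cauchy #|A1| #|B1|).1; move: h1; clear; lia.
have hM1 : 2 * missing A1 B1 <= r.-1 * n.
  by have := (nat_Cauchy #|A1| #|B1|).1; move: h1; clear; lia.
have [] := sides #|A1| #|B1| (400 * missing A1 B1 + 61 * (p1 * n)).
  by move: h1; clear; lia.
move=> s1 s2.
have hA1 : 42 * n <= 100 * #|A1| by move: hp1 hn2 s1 s2 c1; clear; lia.
have hB1 : 42 * n <= 100 * #|B1| by move: hp1 hn2 s1 s2 c1; clear; lia.
have bound x y M : 42 * n <= 100 * y -> x * (y - W) <= 2 * M ->
    2 * M <= r.-1 * n -> 10 * x <= 27 * r.-1.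
  move=> hy hx hM'; rewrite -(leq_pmul2r n0).
  have := leq_mul (leqnn x) (_ : 384 * n <= 1000 * (y - W)).
  by move/(_ ltac:(move: hW hy; clear; lia)); move: hx hM'; clear; lia.
have bA := bound _ _ _ hB1 (dense_exceptions W A1 B1) hM1.
have bB : 10 * #|B1 :\: dense W A1| <= 27 * r.-1.
  by apply: bound hA1 (dense_exceptions W B1 A1) _; rewrite missingC.
have ht : 12 * t <= n.
  apply: leq_trans (leq_divM n (4 * r)); rewrite mulnC leq_mul2l.
  by move: r3; clear; lia.
have t5 : 5 <= t.
  rewrite leq_divRL; last by move: r3; clear; lia.
  apply: leq_trans hn3; rewrite mulnCA leq_mul2l /= -mulnA mulnC leq_mul2l.
  by apply/orP; right; apply: (@leq_mul 1 5 (r + 1) (r + 2)); move: r3; clear;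
    lia.
have cA : W + #|A1 :\: dense W B1| <= #|A1|.
  by move: hA1 bA hW hn2; clear; lia.
have cB : W + #|B1 :\: dense W A1| <= #|B1|.
  by move: hB1 bB hW hn2; clear; lia.
have tA : 2 * t + 2 * #|A1 :\: dense W B1| <= W + #|A1|.
  by move: hA1 bA n280 ht hn2; clear; lia.
have tB : 2 * t + 2 * #|B1 :\: dense W A1| <= W + #|B1|.
  by move: hB1 bB n280 ht hn2; clear; lia.
have H := Refinable k2 cf (leqnn W) t5 cA cB tA tB.
exists A1, B1; split=> // LA LB A B p q.
have h := refine_balance H; have hc := refine_card H.
have ho := refine_outside H d1.
(* Each of the [q] non-dense vertices misses at least this many vertices of the opposite side. Since
   8p is smaller, the bound on [4 * (p * q)] follows. *)
have hm : q * (17 * n %/ 100) <= 2 * missing A B.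
  apply: (refine_missing H).
    by move: hA1 bA hW hn2; clear; lia.
  by move: hB1 bB hW hn2; clear; lia.
move: h hc ho; rewrite -/LA -/LB -/A -/B -/p -/q cG => h hc ho.
rewrite -/LA -/LB in bA bB.
have hpq : p + q <= 9 * r.-1 by move: ho bA bB hp1 c1; clear; lia.
(* The part 8t is at most 2n/3, and 4q+3p is at most 36(r-1), hence at most 36n/140. *)
have coef : 1000 * (8 * t + 4 * q + 3 * p) <= 925 * n.
  by move: hpq hn2 ht; clear; lia.
have hp : p <= 2 * r.-1.
  rewrite -(leq_pmul2r n0); have := leq_mul (leqnn p) coef.
  have := (nat_Cauchy #|A| #|B|).1; move: h; clear; lia.
have {}coef := leq_mul (leqnn p) coef.
have hM : 2 * missing A B <= r.-1 * n.
  by have := (nat_Cauchy #|A| #|B|).1; move: h coef; clear; lia.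
have [] := sides #|A| #|B| 0 _; first by move: h coef; clear; lia.
move=> s3 s4; split=> //.
- have := leq_mul (leqnn q) (_ : 8 * p <= 17 * n %/ 100).
  by move/(_ ltac:(move: hp hn2 n280; clear; lia)); move: hm; clear; lia.
- by move: hc hp hn2 s3 s4; clear; lia.
by move: hc hp hn2 s3 s4; clear; lia.
Qed.

End Steps.

(** * The vertices outside the core *)

Lemma refinable_sym (G : sgraph) k W t (A1 B1 : {set G}) :
  refinable k W t A1 B1 -> refinable k W t B1 A1.
Proof. by case=> *; split. Qed.

(** The neighbourhoods of [x] and [y] in [Y] are disjoint, so these two vertices alone miss [#|Y|]
    pairs. *)
Lemma missing_no_common (G : sgraph) (X Y : {set G}) x y :
  x \in X -> y \in X -> x != y ->
  (forall z, z \in Y -> ~~ (adj x z && adj y z)) -> #|Y| <= missing X Y.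
Proof.
move=> xX yX xy h; have hs : missing [set x; y] Y <= missing X Y.
  by apply: missing_sub => //; apply/subsetP => z /set2P[]->.
apply: leq_trans hs.
rewrite /missing /pairs cards2 xy big_setU1 ?inE //= big_set1.
suff : deg x Y + deg y Y <= #|Y| by clear; lia.
rewrite -cardsUI; have /eqP -> : #|(nbr x :&: Y) :&: (nbr y :&: Y)| == 0.
  rewrite cards_eq0; apply/eqP/setP => z; rewrite !inE.
  by apply/negbTE/negP => /andP[/andP[xz zY] /andP[yz _]]; case/negP: (h z zY);
    rewrite xz.
by rewrite addn0 -setIUl subset_leq_card ?subsetIr.
Qed.

(** Arithmetic behind the bound r-1 on the outside vertices. Here r+d is their number, u the
    threshold, a and b the side sizes, x the floor, y and z the binomials for r and r+d. As n-r+1 =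
    (a+b)+(d+1), the assumed edge count contains a term (a+b)(d+1)/2, which the (r+d)u edges from
    outside and the smaller terms cannot match for large n. *)
Lemma excess_vertices n r d u x y z M a b q e :
  3 <= r -> e + M <= a * b + (r + d) * (u.-1 + q) + z ->
  x + y <= e -> a + b + (r + d) = n -> 4 * (a * b) <= (a + b) ^ 2 ->
  (n - r - d + d.+1) ^ 2 <= 4 * x + 3 -> u * (4 * r) <= n ->
  2 * y = r * r.-1 -> 2 * z = (r + d) * (r + d).-1 ->
  4 * ((r + d) * q) <= M -> r + d <= 2 * r.-1 ->
  n < 4 * (r * (r + 1) * (r + 2)).
Proof.
move=> r3 he he0 hc hab h4 ht h2 h3 hpq hp; rewrite ltnNge; apply/negP => hn3.
have eN : n - r - d = a + b by move: hc; clear; lia.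
rewrite {}eN in he0 h4.
have e1 : (a + b + d.+1) ^ 2 = (a + b) ^ 2 + 2 * ((a + b) * d.+1) + d.+1 ^ 2.
  by clear; lia.
rewrite e1 in h4.
have k1 : 2 * ((a + b) * d.+1) + 2 * (r * r.-1) <=
    4 * ((r + d) * u) + 2 * ((r + d) * (r + d)) + 3.
  have : (r + d) * u.-1 <= (r + d) * u by rewrite leq_mul2l leq_pred orbT.
  have : (r + d) * (r + d).-1 <= (r + d) * (r + d).
    by rewrite leq_mul2l leq_pred orbT.
  by move: he he0 hab h4 h2 h3 hpq; clear; lia.
have rd : r + d <= r * d.+1 by move: r3; clear; nia.
have k2 : (a + b) * d.+1 <= (2 * (r * u) + r * (r + d)) * d.+1.
  have := leq_mul rd (leqnn u); have := leq_mul rd (leqnn (r + d)).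
  have : 3 <= 2 * (r * r.-1) by move: r3; clear; nia.
  by move: k1; clear; lia.
have {}k2 : a + b <= 2 * (r * u) + r * (r + d) by rewrite leq_pmul2r in k2.
have : n <= 2 * ((r + 1) * (r + d)) by move: k2 hc ht; clear; lia.
have : (r + 1) * (r + d) <= (r + 1) * (2 * r.-1) by rewrite leq_mul2l hp orbT.
move: hn3 r3; clear; nia.
Qed.

Section Outside.
Variables (G : sgraph) (n k r : nat).
Hypotheses (cG : #|G| = n) (hr : 3 <= r <= 2 * k).
Hypothesis he0 : (n - r + 1) ^ 2 %/ 4 + 'C(r, 2) <= #|edges G|.
Hypotheses (hn1 : 40 * (2 * k + r) <= n).
Hypothesis hn3 : 4 * (r * (r + 1) * (r + 2)) <= n.
Local Notation W := (2 * k + 6).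
Local Notation t := (n %/ (4 * r)).

Section Side.
Variables (A1 B1 : {set G}).
Local Notation LA := (dense W B1).
Local Notation LB := (dense W A1).
Local Notation A := (attached t LB).
Local Notation B := (attached t LA).
Local Notation P := (~: (A :|: B)).
Local Notation q := (#|A :\: LA| + #|B :\: LB|).
Hypothesis H : refinable k W t A1 B1.
Hypothesis hp : #|P| <= 2 * r.-1.
Hypothesis hM : 2 * missing A B <= r.-1 * n.
Hypothesis hpq : 4 * (#|P| * q) <= missing A B.
Hypothesis hb : 43 * n <= 100 * #|B|.
Let k2 := refinable_k H.

(** For k = 2, r is 3 or 4, and the missing pairs are linear in n while (t-2)^2 is quadratic. The
    constants 20 and 30 are the lower bounds (r+1)(r+2) on [t]. *)
Lemma missing_lt_sq : k = 2 -> missing A B < (t - 2) ^ 2.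
Proof.
move=> ek; have r0 : 0 < 4 * r by move: hr; clear; lia.
have := ltn_ceil n r0; have t20 : (r + 1) * (r + 2) <= t.
  by rewrite leq_divRL //; apply: leq_trans hn3; clear; lia.
move: hM hn1 hn3 r0 t20 hr; rewrite ek; move: (missing _ _) => M.
move: (n %/ _) => u; clear=> hM hn1 hn3 r0 t20 hr hu.
have [er|er] : r = 3 \/ r = 4 by move: hr; lia.
  subst r; have [s es] : exists s, u = s + 20 by exists (u - 20); move: t20;
    lia.
  have s3 : 3 <= s by move: hu hn1; rewrite es; lia.
  by rewrite es -addnBA // -mulnn; move: hM hu s3; rewrite es /=; clear; nia.
subst r; have [s es] : exists s, u = s + 30 by exists (u - 30); move: t20; lia.
by rewrite es -addnBA // -mulnn; move: hM hu; rewrite es /=; clear; nia.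
Qed.

Lemma outside_one_sided u x y : x \in A -> y \in B -> adj u x -> ~~ adj u y.
Proof.
exact: (one_sided k2 (refinable_free H) (refinable_W H) (refinable_t H)
  (refine_linkedA H) (refine_linkedB H) (refine_subA H) (refine_subB H)
  missing_lt_sq).
Qed.

(** An outside vertex has neighbours on one side only, so the degree bound [t.-1 + q] is paid once
    rather than once per side. *)
Lemma edges_missing_bound :
  #|edges G| + missing A B <=
  #|A| * #|B| + #|P| * (t.-1 + q) + 'C(#|P|, 2).
Proof.
have := refine_edges H; have := missingE A B; have := mul2_bin2 #|P|.
have : pairs P P <= #|P| * #|P|.-1.
  by apply: pairs_const => u uP; apply: deg_self.
have : pairs P (A :|: B) <= #|P| * (t.-1 + q).
  apply: pairs_const => u uP; apply: leq_trans (deg_U _ _ _) _.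
  have [/exists_inP[x xA ux]|/exists_inPn h] := boolP [exists x in A, adj u x].
    have /eqP -> : deg u B == 0.
      by apply/deg_eq0 => y yB; apply: outside_one_sided ux.
    by have := refine_degA uP; clear; lia.
  have /eqP -> : deg u A == 0 by apply/deg_eq0.
  by have := refine_degB uP; clear; lia.
by clear; lia.
Qed.

Lemma card_outside : #|P| <= r.-1.
Proof.
have he := edges_missing_bound; have hc := refine_card H.
have r3 : 3 <= r by case/andP: hr.
rewrite leqNgt; apply/negP => gt.
have [d ed] : exists d, #|P| = r + d.
  by exists (#|P| - r); move: gt; clear; lia.
have hab : 4 * (#|A| * #|B|) <= (#|A| + #|B|) ^ 2.
  exact: (nat_AGM2 #|A| #|B|).1.
have h4 : (n - r + 1) ^ 2 <= 4 * ((n - r + 1) ^ 2 %/ 4) + 3.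
  by have := divn_eq ((n - r + 1) ^ 2) 4; have := ltn_mod ((n - r + 1) ^ 2) 4;
    clear; lia.
have ht : t * (4 * r) <= n by exact: leq_divM.
have h2 := mul2_bin2 r; have h3 := mul2_bin2 #|P|.
rewrite cG ed in hc.
have en : n - r + 1 = n - r - d + d.+1 by move: hc; clear; lia.
have he0' := he0; have hp' := hp; have hpq' := hpq.
rewrite en in he0' h4; rewrite ed in he h3 hp' hpq'.
have := excess_vertices r3 he he0' hc hab h4 ht h2 h3 hpq' hp'.
by rewrite ltnNge hn3.
Qed.

(** For k = 2 a common neighbour of [x] and [y] must be found. Without one, at least [#|B|], that is
    0.43n, pairs are missing; but when [#|P|] is r-1 the edge count allows at most n/4 plus a
    quarter of the missing pairs, hence at most n/3. *)
Lemma attachment_unique u v x y :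
  3 <= k \/ #|P| = r.-1 -> u \in P -> v \in P -> x \in A -> y \in A ->
  adj u v -> adj u x -> adj v y -> x = y.
Proof.
move=> hkp uP vP xA yA uv ux vy; apply/eqP; case: eqVneq => // xy.
have uP' : u \notin A :|: B by rewrite -in_setC.
have vP' : v \notin A :|: B by rewrite -in_setC.
suff hk : k = 2 -> exists2 z, z \in B & adj x z && adj y z.
  by case/eqP: xy; apply: (same_attachment k2 (refinable_free H) (refinable_W H)
    (refinable_t H) (refine_linkedB H) hk uP' vP').
move=> ek; apply/exists_inP;
  case: (boolP [exists z in B, _]) => // /exists_inPn h.
have hbM := missing_no_common xA yA xy h.
have ep : #|P| = r.-1 by case: hkp => //; rewrite ek.
have he := edges_missing_bound; have hc := refine_card H.
have hab : #|A| * #|B| <= (n - r + 1) ^ 2 %/ 4.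
  rewrite leq_divRL // mulnC.
  apply: leq_trans (nat_AGM2 #|A| #|B|).1 _.
  by rewrite leq_sqr; move: hc; rewrite cG ep; move: hr; clear; lia.
have ht : t * (4 * r) <= n by exact: leq_divM.
have h2 := mul2_bin2 r; have h3 := mul2_bin2 #|P|.
have n0 : 0 < n by move: hn1 hr; clear; lia.
have hC : 'C(#|P|, 2) <= 'C(r, 2) by rewrite leq_bin2l // ep leq_pred.
have : 4 * (#|P| * t.-1) <= n.
  apply: leq_trans ht; rewrite ep.
  by have := leq_mul (leq_pred r) (leq_pred t); clear; lia.
move: he he0 hab hC hbM hpq hb n0; clear; lia.
Qed.

End Side.
End Outside.

(** * Cuts *)

Record core (G : sgraph) (A B : {set G}) : Prop := Core {
  core_disjoint : [disjoint A & B];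
  core_indepA : forall x y, x \in A -> y \in A -> ~~ adj x y;
  core_indepB : forall x y, x \in B -> y \in B -> ~~ adj x y;
  core_one_sided : forall u x y, x \in A -> y \in B -> adj u x -> ~~ adj u y
}.

Definition tied (G : sgraph) (A B : {set G}) : Prop :=
  forall u v x y, u \notin A :|: B -> v \notin A :|: B ->
    adj u v -> adj u x -> adj v y ->
    x \in A /\ y \in A \/ x \in B /\ y \in B -> x = y.

(** The restriction on [tied] comes from k = 2, where the common neighbour is only guaranteed if the
    outside set has full size. *)
Lemma core_exists (G : sgraph) n k r :
  #|G| = n -> 2 <= k -> 3 <= r <= 2 * k ->
  2 * (r + 2) * (r + 1) * (r + 2 * k) <= n -> cycle_free (2 * k + 1) G ->
  (n - r + 1) ^ 2 %/ 4 + 'C(r, 2) <= #|edges G| ->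
  exists A B : {set G},
    [/\ core A B, #|~: (A :|: B)| <= r.-1
      & 3 <= k \/ #|~: (A :|: B)| = r.-1 -> tied A B].
Proof.
move=> cG k2 hr hn cf he0.
have [hn1 hn2 hn3] := order_bounds k2 hr hn.
have he : n ^ 2 <= 4 * #|edges G| + 2 * (r.-1 * n).
  by apply: edge_bound he0; move: hr hn1; clear; lia.
have [A1 [B1 [H /= [hp hM hpq ha hb]]]] :=
  second_refinement cG k2 hr cf he hn1 hn2 hn3.
set A := attached _ (dense _ A1) in hp hM hpq ha hb.
set B := attached _ (dense _ B1) in hp hM hpq ha hb.
have H' := refinable_sym H.
exists A, B; split.
- split.
  + exact: refine_disjoint H.
  + exact: refine_indepA H.
  + exact: refine_indepB H.
  exact: outside_one_sided H hM.
- exact: card_outside H hp hM hpq.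
move=> hkp u v x y uP vP uv ux vy; rewrite -!in_setC in uP vP.
case=> [[xA yA]|[xB yB]].
  exact: (attachment_unique cG hr he0 hn1 hn3 H hM hpq hb hkp uP vP).
(* The case of [B] is that of [A] for the swapped bipartition. *)
have eAB : A :|: B = B :|: A by rewrite setUC.
rewrite eAB in uP vP hkp hpq; rewrite missingC in hM hpq; rewrite addnC in hpq.
exact: (attachment_unique cG hr he0 hn1 hn3 H' hM hpq ha hkp uP vP).
Qed.

(** * Greedy extension of a cut *)

Section MaxCut.
Variable G : sgraph.
Implicit Types (S Z D : {set G}) (e : {set G}).

(** Empty exactly when [S] and its complement properly 2-colour the subgraph induced by [Z]. Keeping
    [Z] as a parameter allows vertices to be added one at a time. *)
Definition uncut S Z : {set {set G}} :=
  [set e in edges G | (e \subset Z) && ((e \subset S) || (e \subset ~: S))].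

Lemma uncutP S Z e : reflect
  (exists x y, [/\ e = [set x; y], adj x y, x \in Z, y \in Z
                 & (x \in S) = (y \in S)])
  (e \in uncut S Z).
Proof.
apply: (iffP idP) => [|[x [y [-> xy xZ yZ xyS]]]].
  rewrite inE => /and3P[/imsetP[[x y]]]; rewrite inE /= => xy -> sZ sS.
  exists x, y; move: sZ sS; rewrite !subUset !sub1set !inE => /andP[-> ->].
  by case/orP=> /andP[]; do 2![case: (_ \in S)].
rewrite inE !subUset !sub1set !inE xZ yZ xyS /= !andbb orbN andbT.
by apply/imsetP; exists (x, y); rewrite ?inE.
Qed.

Lemma gamma2_le S : gamma2 G <= #|uncut S [set: G]|.
Proof.
have [_ ] := (gamma2P G (gamma2 G)).1 erefl; apply.
  by apply/subsetP => e; rewrite inE => /andP[].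
apply/existsP; exists S; apply/forallP => x; apply/forallP => y.
apply/implyP => /andP[xy]; apply: contra => /eqP xyS.
by apply/uncutP; exists x, y; split; rewrite ?inE.
Qed.

Lemma d2_le S Z : uncut S Z = set0 -> d2 G <= #|~: Z|.
Proof.
move=> u0; have [_ ] := (d2P G (d2 G)).1 erefl; apply.
apply/existsP; exists [set z | val z \in S]; apply/forallP => x.
apply/forallP => y; apply/implyP => /= xy; rewrite !inE.
apply/negP => /eqP xyS; suff: [set val x;
  val y] \in uncut S Z by rewrite u0 inE.
apply/uncutP; exists (val x), (val y); split=> //.
  by have := valP x; rewrite inE negbK.
by have := valP y; rewrite inE negbK.
Qed.

(** The vertex [v] joins the side containing fewer of its neighbours. *)
Lemma uncut_add S Z v : v \notin Z ->
  exists S', #|uncut S' (v |: Z)| <= #|uncut S Z| + (deg v Z)./2.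
Proof.
move=> vZ.
(* Serves both placements of [v]: [T] describes the vertices of [Z] that end up on its side. *)
have sub (S' T : {set G}) : (forall z, z \in Z -> (z \in S') = (z \in S)) ->
    (forall z, z \in Z -> ((v \in S') == (z \in S)) = (z \in T)) ->
    #|uncut S' (v |: Z)| <= #|uncut S Z| + deg v (Z :&: T).
  move=> hS hT; apply: leq_trans (leq_add (leqnn _) (leq_imset_card
    (fun z => [set v; z]) (nbr v :&: (Z :&: T)))).
  apply: leq_trans (leq_card_setU _ _); apply: subset_leq_card.
  apply/subsetP => e /uncutP[x [y [-> xy]]]; rewrite !in_setU1 => xZ yZ xyS.
  rewrite in_setU.
  have vT z : z \in Z -> adj v z -> (v \in S') = (z \in S') ->
      [set v; z] \in [set [set v; z0] | z0 in nbr v :&: (Z :&: T)].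
    by move=> zZ vz vzS; apply: imset_f;
      rewrite !inE vz zZ -hT // vzS hS // eqxx.
  move: xy xyS; case/orP: xZ => [/eqP->|xZ]; case/orP: yZ => [/eqP->|yZ] xy xyS.
  - by rewrite adj_irr in xy.
  - by apply/orP; right; apply: vT.
  - by apply/orP; right; rewrite setUC; apply: vT => //; rewrite adj_sym.
  apply/orP; left; apply/uncutP; exists x, y; split=> //.
  by rewrite -!hS.
have h1 := sub (v |: S) S; have h0 := sub (S :\ v) (~: S).
have : deg v (Z :&: S) + deg v (Z :&: ~: S) = deg v Z.
  by rewrite -setDE -deg_ID.
have neq z : z \in Z -> (z == v) = false.
  by move=> zZ; apply: contraNF vZ => /eqP <-.
have {}h1 : #|uncut (v |: S) (v |: Z)| <= #|uncut S Z| + deg v (Z :&: S).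
  by apply: h1 => z zZ; rewrite !inE ?eqxx ?neq //; case: (z \in S).
have {}h0 : #|uncut (S :\ v) (v |: Z)| <= #|uncut S Z| + deg v (Z :&: ~: S).
  by apply: h0 => z zZ; rewrite !inE ?eqxx ?neq //; case: (z \in S).
have [le|le] := leqP (deg v (Z :&: S)) (deg v (Z :&: ~: S)) => hd.
  by exists (v |: S); move: h1 le hd; clear; lia.
by exists (S :\ v); move: h0 le hd; clear; lia.
Qed.

(** The number of edges of the complete graph on [m] vertices left inside the parts of a balanced
    bipartition. Its increment [m./2] is also the greedy cost of adding a vertex of degree [m]. *)
Definition two_cliques m := 'C(m./2, 2) + 'C(uphalf m, 2).

Lemma two_cliquesS m : two_cliques m.+1 = two_cliques m + m./2.
Proof. by rewrite /two_cliques /= binS bin1 addnCA addnA. Qed.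

Lemma two_cliques_mono m m' : m <= m' -> two_cliques m <= two_cliques m'.
Proof.
move=> /subnK <-; elim: (m' - m) => [|i IHi] //.
by rewrite addSn two_cliquesS (leq_trans IHi) ?leq_addr.
Qed.

(** The bound [c] grows by one with each added vertex, since later ones may be adjacent to it. The
    costs are halves of c, c+1, and so on, which telescope by [two_cliquesS]. *)
Lemma greedy_cut D S Z c :
  [disjoint D & Z] -> (forall v, v \in D -> deg v Z <= c) ->
  exists S', #|uncut S' (D :|: Z)| + two_cliques c
             <= #|uncut S Z| + two_cliques (c + #|D|).
Proof.
have [m] := ubnP #|D|; elim: m D S Z c => // m IHm D S Z c cD dD hD.
have [->|/set0Pn[v vD]] := eqVneq D set0.
  by exists S; rewrite set0U cards0 addn0.
have vZ : v \notin Z by rewrite (disjointFr dD).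
have [S1 h1] := uncut_add S vZ.
have cD' := cardsD1 v D; rewrite vD in cD'.
have [||w|S2 h2] := IHm (D :\ v) S1 (v |: Z) c.+1.
- by move: cD' cD; clear; lia.
- rewrite disjoint_subset; apply/subsetP => w; rewrite !inE => /andP[wv wD].
  by rewrite (negbTE wv) (disjointFr dD wD).
- rewrite inE => /andP[_ wD]; apply: leq_trans (deg_U _ _ _) _.
  rewrite -add1n leq_add ?hD //; apply: leq_trans (deg_le _ _) _.
  by rewrite cards1.
exists S2; move: h2; rewrite setUCA setUA setD1K //.
rewrite two_cliquesS cD' addSnnS add1n => h2.
by have := half_leq (hD v vD); move: h1 h2; clear; lia.
Qed.

End MaxCut.

(** * Extending the bipartition of the core *)

Section CoreCut.
Variables (G : sgraph) (A B : {set G}).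
Hypothesis H : core A B.
Implicit Types (S Z Y : {set G}) (u v w x y : G).
Local Notation C := (A :|: B).
Local Notation P := (~: (A :|: B)).

Lemma core_deg u : deg u A = 0 \/ deg u B = 0.
Proof.
case: (posnP (deg u A)); first by left.
case/card_gt0P => x; rewrite !inE => /andP[ux xA]; right.
by apply/eqP/deg_eq0 => y yB; apply: (core_one_sided H xA).
Qed.

(** [S] lists the outside vertices placed with [A]. As these have no neighbour in [A] and the other
    members of [Y] have none in [B], every edge meeting the core is cut. *)
Lemma uncut_core S Y e :
  S \subset P -> Y \subset P ->
  (forall u, u \in Y -> if u \in S then deg u A = 0 else deg u B = 0) ->
  e \in uncut (A :|: S) (C :|: Y) ->
  exists u v, [/\ e = [set u; v], adj u v, u \in Y, v \in Y
                & (u \in S) = (v \in S)].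
Proof.
move=> sS sY hY.
have inC x : x \in C -> (x \in A :|: S) = (x \in A).
  move=> xC; rewrite inE; case: (boolP (x \in S)) => [/(subsetP sS)|].
    by rewrite inE xC.
  by rewrite orbF.
have inY u : u \in Y -> (u \in A :|: S) = (u \in S).
  move=> /(subsetP sY); rewrite !inE negb_or => /andP[/negbTE-> _].
  by [].
have BA x : x \in B -> (x \in A) = false.
  exact: disjointFl (core_disjoint H).
have mixed x u : x \in C -> u \in Y -> adj u x ->
    (x \in A :|: S) = (u \in A :|: S) -> False.
  move=> xC uY ux; rewrite inC // inY //; have := hY u uY.
  case: (u \in S) => /eqP /deg_eq0 h e1.
    by case/negP: (h x e1).
  by move: xC; rewrite inE e1 => /h; rewrite ux.
case/uncutP=> x [y [-> xy]]; rewrite !(in_setU _ C) => xZ yZ xyS.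
case/orP: xZ => [xC|xY]; case/orP: yZ => [yC|yY].
- move: xyS; rewrite !inC //; move: xC yC; rewrite !inE.
  case/orP=> x1; case/orP=> y1.
  + by case/negP: (core_indepA H x1 y1).
  + by rewrite x1 (BA y).
  + by rewrite y1 (BA x).
  by case/negP: (core_indepB H x1 y1).
- by case: (mixed x y) => //; rewrite adj_sym.
- by case: (mixed y x).
by exists x, y; split=> //; rewrite -!inY.
Qed.

(* Outside vertices attached to [B] must join the side of [A]; the unattached
   ones could join either side. *)
Definition free_side : {set G} := [set u in P | deg u A == 0].

Lemma free_side_sub : free_side \subset P.
Proof. by apply/subsetP => u; rewrite inE => /andP[]. Qed.

Lemma free_sideP u :
  u \in P -> if u \in free_side then deg u A = 0 else deg u B = 0.
Proof.
move=> uP; case: (boolP (u \in free_side)); rewrite inE uP /=.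
  by move/eqP.
by case: (core_deg u) => // ->.
Qed.

Lemma core_deg0 u : deg u C = deg u A + deg u B.
Proof. exact: deg_U_disjoint (core_disjoint H). Qed.

Lemma uncut_pair S u v :
  S \subset P -> u \in P -> v \in P ->
  (if u \in S then deg u A = 0 else deg u B = 0) ->
  (if v \in S then deg v A = 0 else deg v B = 0) ->
  (adj u v -> (u \in S) != (v \in S)) ->
  uncut (A :|: S) (C :|: [set u; v]) = set0.
Proof.
move=> sS uP vP hu hv huv; apply/eqP/set0Pn => -[e].
case/(uncut_core sS).
- by apply/subsetP => w /set2P[]->.
- by move=> w /set2P[]->.
move=> x [y [_ xy xuv yuv]]; move: xuv yuv xy.
case/set2P=> ->; case/set2P=> -> + e1; rewrite ?adj_irr //.
  by move/huv; rewrite e1 eqxx.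
by rewrite adj_sym => /huv; rewrite e1 eqxx.
Qed.

Lemma uncut_single u : u \in P -> exists S, uncut S (C :|: [set u]) = set0.
Proof.
(* The pair lemma applies with both vertices equal, because no vertex is adjacent to itself. *)
move=> uP; exists (A :|: free_side); rewrite -(setUid [set u]).
apply: (uncut_pair free_side_sub uP uP (free_sideP uP) (free_sideP uP)).
by rewrite adj_irr.
Qed.

Lemma uncut_outside : #|uncut (A :|: free_side) [set: G]| <= 'C(#|P|, 2).
Proof.
rewrite -cards_draws; apply: subset_leq_card; apply/subsetP => e.
rewrite -(setUCr C) => /(uncut_core free_side_sub (subxx _)) [].
  exact: free_sideP.
move=> x [y [-> xy xP yP _]]; rewrite inE cards2 (adj_neq xy) subUset.
by rewrite !sub1set xP yP.
Qed.

Hypothesis hT : tied A B.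

(** Non-adjacent vertices, or vertices attached to different sides, are placed by [free_side]. A
    vertex without core neighbours goes opposite the other one. Only adjacent vertices attached to
    the same side remain, and [tied] gives them a single common attachment. *)
Lemma pair_cut u v : u \in P -> v \in P -> u != v ->
  (exists S, uncut S (C :|: [set u; v]) = set0) \/
  adj u v /\ exists2 w,
    w \in C & nbr u :&: C = [set w] /\ nbr v :&: C = [set w].
Proof.
move=> uP vP uv; have uvC := (uP, vP); rewrite !in_setC in uvC.
have [adjuv|nadj] := boolP (adj u v); last first.
  left; exists (A :|: free_side).
  apply: (uncut_pair free_side_sub uP vP (free_sideP uP) (free_sideP vP)).
  by rewrite (negbTE nadj).
have aux x y : x \in P -> y \in P -> x != y -> deg x C = 0 ->
    exists S, uncut S (C :|: [set x; y]) = set0.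
  move=> xP yP xy /eqP; rewrite core_deg0 addn_eq0 => /andP[/eqP xA /eqP xB].
  case: (boolP (y \in free_side)) => yF; have := free_sideP yP.
    rewrite yF => yA; exists (A :|: [set y]); apply: uncut_pair => //.
    - by rewrite sub1set.
    - by rewrite inE (negbTE xy).
    - by rewrite set11.
    by move=> _; rewrite set11 in_set1 (negbTE xy).
  rewrite (negbTE yF) => yB; exists (A :|: [set x]); apply: uncut_pair => //.
  - by rewrite sub1set.
  - by rewrite set11.
  - by rewrite inE eq_sym (negbTE xy).
  by move=> _; rewrite set11 in_set1 [y == x]eq_sym (negbTE xy).
have [/(aux u v uP vP uv)|u0] := posnP (deg u C); first by left.
have [v0|v0] := posnP (deg v C).
  left; have [|S hS] := aux v u vP uP _ v0; first by rewrite eq_sym.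
  by exists S; rewrite setUC in hS *; rewrite setUC (setUC [set u]).
case: (boolP ((u \in free_side) == (v \in free_side))) => [/eqP e|ne].
  right; split=> //.
  have same x y : adj u x -> adj v y -> x \in C -> y \in C -> x = y.
    move=> ux vy xC yC; apply: (hT uvC.1 uvC.2 adjuv ux vy).
    have := free_sideP uP; have := free_sideP vP; rewrite -e.
    move: xC yC; rewrite !in_setU => xC yC.
    case: ifP => _ /eqP/deg_eq0 hv /eqP/deg_eq0 hu.
      right; split.
        by case/orP: xC => // /hu; rewrite ux.
      by case/orP: yC => // /hv; rewrite vy.
    left; split.
      by case/orP: xC => // /hu; rewrite ux.
    by case/orP: yC => // /hv; rewrite vy.
  case/card_gt0P: u0 => x /setIP[]; rewrite in_nbr => ux xC.
  case/card_gt0P: v0 => y /setIP[]; rewrite in_nbr => vy yC.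
  have exy := same _ _ ux vy xC yC; exists x => //.
  split; apply/setP => z; rewrite in_setI in_nbr in_set1.
    apply/andP/eqP => [[uz zC]|-> //].
    by rewrite (same _ _ uz vy zC yC).
  apply/andP/eqP => [[vz zC]|->]; last by rewrite exy.
  by rewrite (same _ _ ux vz xC zC).
left; exists (A :|: free_side).
exact: (uncut_pair free_side_sub uP vP (free_sideP uP) (free_sideP vP)).
Qed.

(** [Q] gathers the outside vertices with at least two core neighbours. If it has two members, all
    of [Q] can be kept, since [tied] forbids an edge between members on the same side. A single
    member is kept with any other vertex. If [Q] is empty, either some pair can be kept or every
    pair is adjacent with a common attachment. *)
Lemma core_dichotomy : 2 <= #|P| ->
  (exists Y S, [/\ Y \subset P, 2 <= #|Y|, uncut S (C :|: Y) = set0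
                 & forall u, u \in P :\: Y -> deg u C <= 1]) \/
  (exists2 w, w \in C & (forall u, u \in P -> nbr u :&: C = [set w]) /\
     forall u v, u \in P -> v \in P -> u != v -> adj u v).
Proof.
move=> cP; set Q := [set u in P | 1 < deg u C].
have sQ : Q \subset P by apply/subsetP => u; rewrite inE => /andP[].
have pairY u v : u \in P -> v \in P -> [set u; v] \subset P.
  by move=> uP vP; apply/subsetP => x /set2P[]->.
have [cQ|] := leqP 2 #|Q|.
  left; exists Q, (A :|: free_side); split=> //; last first.
    by move=> u; rewrite in_setD [u \in Q]inE => /andP[+ uP];
      rewrite uP /= -leqNgt.
  apply/eqP/set0Pn => -[e]; case/(uncut_core free_side_sub sQ) => [u uQ|].
    by apply: free_sideP; apply: (subsetP sQ).
  move=> u [v [_ uv uQ vQ e1]].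
  have uP := subsetP sQ _ uQ; have vP := subsetP sQ _ vQ.
  case: (pair_cut uP vP (adj_neq uv)) => [|[_ [w _ [hu _]]]]; last first.
    by move: uQ; rewrite inE /deg hu cards1 andbF.
  have := free_sideP uP; have := free_sideP vP; rewrite -e1.
  have [x0 [xu xC]] : exists x, adj u x /\ x \in C.
    move: uQ; rewrite inE => /andP[_] /ltnW /card_gt0P[x].
    by rewrite in_setI in_nbr => /andP[]; exists x.
  have [y] : exists2 y, y \in nbr v :&: C & y \notin [set x0].
    by apply: card_pick; rewrite cards1; move: vQ; rewrite inE => /andP[].
  rewrite in_setI in_nbr in_set1 => /andP[vy yC] /eqP ne hv hu _; case: ne.
  symmetry; move: uP vP; rewrite !in_setC => uP vP.
  apply: (hT uP vP uv xu vy); move: xC yC; rewrite !in_setU => xC yC.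
  move: hv hu; case: ifP => _ /eqP/deg_eq0 hv /eqP/deg_eq0 hu.
    right; split; first by case/orP: xC => // /hu; rewrite xu.
    by case/orP: yC => // /hv; rewrite vy.
  left; split; first by case/orP: xC => // /hu; rewrite xu.
  by case/orP: yC => // /hv; rewrite vy.
rewrite ltnS leq_eqVlt ltnS leqn0 => /orP[/cards1P[u eQ]|/eqP cQ].
  have : u \in Q by rewrite eQ set11.
  rewrite inE => /andP[uP du].
  have [v vP] : exists2 v, v \in P & v \notin [set u].
    by apply: card_pick; rewrite cards1.
  rewrite in_set1 eq_sym => uv.
  case: (pair_cut uP vP uv) => [[S hS]|[_ [w _ [hu _]]]]; last first.
    by move: du; rewrite /deg hu cards1.
  left; exists [set u; v], S; split=> //; first exact: pairY.
    by rewrite cards2 uv.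
  move=> z; rewrite in_setD => /andP[nz zP]; rewrite leqNgt; apply/negP => dz.
  have : z \in Q by rewrite inE zP.
  by rewrite eQ => /set1P ez; case/negP: nz; rewrite ez set21.
have small u : u \in P -> deg u C <= 1.
  move=> uP; rewrite leqNgt; apply/negP => du.
  have : u \in Q by rewrite inE uP.
  by rewrite (cards0_eq cQ) inE.
case: (boolP [exists u in P, [exists v in P, (u != v) &&
   [exists S : {set G}, uncut S (C :|: [set u; v]) == set0]]]).
  case/exists_inP => u uP /exists_inP[v vP /andP[uv /existsP[S /eqP hS]]].
  left; exists [set u; v], S; split=> //; first exact: pairY.
    by rewrite cards2 uv.
  by move=> z /setDP[zP _]; apply: small.
move=> nex.
have all_pairs u v : u \in P -> v \in P -> u != v -> adj u v /\
    exists2 w, w \in C & nbr u :&: C = [set w] /\ nbr v :&: C = [set w].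
  move=> uP vP uv; case: (pair_cut uP vP uv) => // -[S hS].
  case/negP: nex; apply/exists_inP; exists u => //; apply/exists_inP.
  by exists v => //; rewrite uv; apply/existsP; exists S; apply/eqP.
right; have [u uP] : exists u, u \in P by apply/card_gt0P; apply: ltnW.
have [v vP] : exists2 v, v \in P & v \notin [set u].
  by apply: card_pick; rewrite cards1.
rewrite in_set1 eq_sym => uv.
have [_ [w wC [hu _]]] := all_pairs u v uP vP uv.
exists w => //; split=> [z zP|x y xP yP xy]; last by case: (all_pairs x y).
have [<- //|uz] := eqVneq u z.
by have [_ [w' _ [hu' ->]]] := all_pairs u z uP zP uz; rewrite -hu' hu.
Qed.

End CoreCut.

(** * The extremal graph *)

(** Twice ['C(a, 2)] is a^2 - a and the sum a+b is fixed, so this says that a sum of two squares is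
    least for the balanced split. *)
Lemma two_cliques_min a b : two_cliques (a + b) <= 'C(a, 2) + 'C(b, 2).
Proof.
rewrite /two_cliques; have e : (a + b)./2 + uphalf (a + b) = a + b.
  by rewrite addnC uphalf_half -addnA addnn odd_double_half.
have : uphalf (a + b) <= (a + b)./2 + 1.
  by rewrite uphalf_half; case: odd; clear; lia.
have : (a + b)./2 <= uphalf (a + b) by rewrite uphalf_half leq_addl.
have h1 := mul2_bin2 a; have h2 := mul2_bin2 b.
have h3 := mul2_bin2 (a + b)./2; have h4 := mul2_bin2 (uphalf (a + b)).
move: e h1 h2 h3 h4; move: _./2 (uphalf _) => h u.
move: 'C(a, 2) 'C(b, 2) 'C(h, 2) 'C(u, 2) => x y z w.
have sq m : m * m.-1 + m = m * m by case: m => // m; rewrite [RHS]mulnS addnC.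
have := sq a; have := sq b; have := sq h; have := sq u; clear.
move: (a * a.-1) (b * b.-1) (h * h.-1) (u * u.-1) => a' b' h' u'.
move=> su sh sb sa e ea eb eh eu hu uh.
suff : h * h + u * u <= a * a + b * b by lia.
have [s es] : exists s, u = h + s by exists (u - h); lia.
have s1 : s <= 1 by lia.
have [ah|ah] := leqP a h.
  have [d ed] : exists d, h = a + d by exists (h - a); lia.
  have eb' : b = a + d + d + s by lia.
  by rewrite eb' es ed; clear; nia.
have [d ed] : exists d, a = h + s + d by exists (a - (h + s)); lia.
have eh' : h = b + d by lia.
by rewrite ed es eh'; clear; nia.
Qed.

(** After the deletion each side retains at most one vertex of the clique. *)
Lemma clique_d2 (G : sgraph) (K : {set G}) :
  (forall x y, x \in K -> y \in K -> x != y -> adj x y) -> #|K| - 2 <= d2 G.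
Proof.
move=> hK; have [[S /existsP[A0 bA] <-] _] := (d2P G (d2 G)).1 erefl.
have bip x y : x \in K :\: S -> y \in K :\: S -> x != y ->
    (x \in [set val z | z in A0]) != (y \in [set val z | z in A0]).
  rewrite !inE => /andP[xS xK] /andP[yS yK] xy.
  have := forallP (forallP bA (Sub x xS)) (Sub y yS).
  by rewrite /= /del_vertices_adj /= hK //= -!(mem_imset _ _ val_inj) !SubK.
set A := [set val z | z in A0] in bip.
have c1 : #|(K :\: S) :&: A| <= 1.
  apply/card_le1_eqP => x y /setIP[xK xA] /setIP[yK yA].
  apply/eqP/negPn/negP => xy.
  by have := bip y x yK xK xy; rewrite xA yA.
have c2 : #|(K :\: S) :\: A| <= 1.
  apply/card_le1_eqP => x y /setDP[xK xA] /setDP[yK yA].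
  apply/eqP/negPn/negP => xy.
  by have := bip y x yK xK xy; rewrite (negbTE xA) (negbTE yA).
have := cardsID A (K :\: S); have := cardsID S K.
have := subset_leq_card (subsetIr K S).
by move: c1 c2; clear; lia.
Qed.

(** A bipartition left by the deletion splits [K] in two, and every pair of clique vertices inside
    one part must have been deleted. *)
Lemma clique_gamma2 (G : sgraph) (K : {set G}) :
  (forall x y, x \in K -> y \in K -> x != y -> adj x y) ->
  two_cliques #|K| <= gamma2 G.
Proof.
move=> hK.
have [[E [_ /existsP[A' bA] <-]] _] := (gamma2P G (gamma2 G)).1 erefl.
set A : {set G} := A' in bA *.
rewrite -(cardsID A K); apply: leq_trans (two_cliques_min _ _) _.
rewrite -!cards_draws.
set D1 := [set _ | _]; set D2 := [set _ | _].
have d12 : [disjoint D1 & D2].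
  rewrite -setI_eq0; apply/eqP/setP => e; rewrite !inE.
  apply/negbTE/negP => /andP[/andP[s1 /eqP c1] /andP[s2 _]].
  have : e \subset (K :&: A) :&: (K :\: A) by rewrite subsetI s1.
  rewrite setIDA setDE -setIA -setIA.
  have -> : A :&: (K :&: ~: A) = set0.
    by apply/setP => z; rewrite !inE; case: (z \in A); rewrite ?andbF.
  by rewrite setI0 subset0 => /eqP e0; rewrite e0 cards0 in c1.
have -> : #|D1| + #|D2| = #|D1 :|: D2|.
  by rewrite cardsU; have := d12; rewrite -setI_eq0 => /eqP->;
    rewrite cards0 subn0.
apply: subset_leq_card; apply/subsetP => e.
have key x y : x \in K -> y \in K -> x != y -> (x \in A) = (y \in A) ->
    [set x; y] \in E.
  move=> xK yK xy xyA; have := forallP (forallP bA x) y.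
  by rewrite /= /del_edges_adj hK //= xyA eqxx implybF negbK.
rewrite in_setU => /orP[]; rewrite in_set => /andP[sub /cards2P[x [y [xy ee]]]];
  move: sub; rewrite {e}ee subUset !sub1set !inE.
  by case/andP=> /andP[xK xA] /andP[yK yA]; apply: key; rewrite ?xA ?yA.
case/andP=> /andP[xA xK] /andP[yA yK]; apply: key => //.
by rewrite (negbTE xA) (negbTE yA).
Qed.

Lemma Tstar_clique (G : sgraph) r n : is_Tstar r n G ->
  exists2 K : {set G}, #|K| = r &
    forall x y, x \in K -> y \in K -> x != y -> adj x y.
Proof.
case=> _ [A [B [K [v [_ [[_ _ cK] ha]]]]]]; exists K => // x y xK yK xy.
by rewrite ha xK yK xy !orbT.
Qed.

(** A clique of r-1 vertices hanging on [w] leaves n-r+1 core vertices and at most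
    [#|A| * #|B| + 'C(r, 2)] edges. The assumed edge count then forces the core to be complete
    bipartite and balanced. *)
Lemma core_Tstar (G : sgraph) (A B : {set G}) n r w :
  core A B -> #|G| = n -> 1 < r -> #|~: (A :|: B)| = r.-1 ->
  (n - r + 1) ^ 2 %/ 4 + 'C(r, 2) <= #|edges G| ->
  w \in A :|: B ->
  (forall u, u \in ~: (A :|: B) -> nbr u :&: (A :|: B) = [set w]) ->
  (forall u v, u \in ~: (A :|: B) -> v \in ~: (A :|: B) -> u != v -> adj u v) ->
  is_Tstar r n G.
Proof.
(* [is_Tstar] gives the smaller size to its first part. *)
wlog le : A B / #|A| <= #|B|.
  move=> hw H cG r1 cP he wC hu ha; have [le|/ltnW le] := leqP #|A| #|B|.
    exact: (hw A B).
  apply: (hw B A) => //; rewrite 1?(setUC B) //.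
  case: H => d iA iB os; split=> //; first by rewrite disjoint_sym.
  by move=> u x y xB yA ux; apply/negP => /(os u y x yA xB); rewrite ux.
move=> H cG r1 cP he wC hu ha.
set C := A :|: B in cP wC hu ha *; set P := ~: C in cP hu ha *.
have dCP : [disjoint C & P] by rewrite -setI_eq0 setICr.
have cC : #|A| + #|B| = n - r + 1.
  have : 0 < #|C| by apply/card_gt0P; exists w.
  have := cardsC C; rewrite cG -/P cP cardsU.
  have := core_disjoint H; rewrite -setI_eq0 => /eqP ->; rewrite cards0 subn0.
  by move: r1; clear; lia.
have hedges : 2 * #|edges G| <= 2 * pairs A B + 2 * #|P| + #|P| * #|P|.-1.
  rewrite handshake (@pairs_setT_U _ C P dCP (setUCr C)).
  have indep (X : {set G}) :
      (forall x y, x \in X -> y \in X -> ~~ adj x y) -> pairs X X = 0.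
    move=> hX; rewrite /pairs big1 // => x xX.
    by apply/eqP/deg_eq0 => y; apply: hX.
  have -> : pairs C C = 2 * pairs A B.
    rewrite pairs_Ul ?(core_disjoint H) // !pairs_Ur ?(core_disjoint H) //.
    rewrite (indep A (core_indepA H)) (indep B (core_indepB H)) (pairsC B A).
    by clear; lia.
  have : pairs P C <= #|P| * 1.
    by apply: pairs_const => u uP; rewrite /deg hu ?cards1.
  have : pairs P P <= #|P| * #|P|.-1.
    by apply: pairs_const => u; apply: deg_self.
  by clear; lia.
have hM := missingE A B.
have hab := (nat_AGM2 #|A| #|B|).1; rewrite cC in hab.
have hbin : 2 * 'C(r, 2) = 2 * #|P| + #|P| * #|P|.-1.
  rewrite mul2_bin2 cP; case: r r1 {he cP cC hab} => [|[|s]] //= _.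
  by clear; lia.
have hdiv : #|A| * #|B| <= (n - r + 1) ^ 2 %/ 4 by rewrite leq_divRL // mulnC.
have M0 : missing A B = 0 by move: he hedges hM hbin hdiv; clear; lia.
have sizes : #|A| = (n - r + 1)./2 /\ #|B| = uphalf (n - r + 1).
  (* The product reaches the floor, so the squared difference of the sizes is at most 3 and the
     sizes differ by at most one. *)
  have hab4 : (n - r + 1) ^ 2 <= 4 * (#|A| * #|B|) + 3.
    have := divn_eq ((n - r + 1) ^ 2) 4; have := ltn_mod ((n - r + 1) ^ 2) 4.
    by move: he hedges hM hbin; clear; lia.
  have {hab4} : #|B| <= #|A| + 1.
    rewrite -cC in hab4; rewrite leqNgt; apply/negP => gt.
    have [d ed] : exists d, #|B| = #|A| + 2 + d.
      by exists (#|B| - (#|A| + 2)); move: gt; clear; lia.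
    by move: hab4; rewrite ed; clear; nia.
  rewrite -cC => leB.
  have [d ed] : exists d : bool, #|B| = #|A| + d.
    by exists (#|B| == #|A|.+1); move: le leB; case: eqP => /=; clear; lia.
  rewrite ed addnA addnn uphalf_half halfD odd_double doubleK.
  by case: d {ed} => /=; split; rewrite ?oddD ?odd_double //=; clear; lia.
have notC u : u \in P -> (u \in A) = false /\ (u \in B) = false.
  by rewrite !inE negb_or => /andP[/negbTE-> /negbTE->].
have wP : w \notin P by rewrite inE negbK.
split=> //; exists A, B, (w |: P), w; split; [split | split].
- exact: core_disjoint H.
- apply/setP => z; rewrite -/C in_setI in_setU1 in_setC in_set1.
  by case: eqVneq => [->|_]; rewrite ?wC //= andbN.
- rewrite -/C setUCA setUCr; apply/setUidPr; exact: subsetT.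
- case: sizes => -> ->; split=> //; rewrite cardsU1 wP cP; move: r1; clear; lia.
have BA x : x \in B -> (x \in A) = false by exact: disjointFl (core_disjoint H).
have AB x : x \in A -> (x \in B) = false by exact: disjointFr (core_disjoint H).
have toC u x : u \in P -> x \in C -> adj u x = (x == w).
  move=> uP xC; have := hu u uP => /setP /(_ x).
  by rewrite in_setI in_nbr xC andbT in_set1.
have PinC x : (x \in P) = ~~ (x \in C) by rewrite in_setC.
move=> x y; rewrite !in_setU1.
have [xP|] := boolP (x \in P); have [yP|] := boolP (y \in P).
- have [-> ->] := notC x xP; have [-> ->] := notC y yP; rewrite !orbT /=.
  have [->|xy] := eqVneq x y; first by rewrite adj_irr.
  by rewrite ha.
- rewrite PinC negbK => yC; rewrite toC //; have [-> ->] := notC x xP.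
  rewrite /= orbT orbF /=; case: eqVneq => //= ->; symmetry.
  by apply: contraNneq wP => <-.
- rewrite PinC negbK => xC; rewrite adj_sym toC //; have [-> ->] := notC y yP.
  rewrite !andbF /= orbT orbF /=; case: eqVneq => //= ->.
  by symmetry; apply: contraNneq wP => ->.
rewrite !PinC !negbK !orbF => yC xC.
have -> : [&& x == w, y == w & x != y] = false.
  by case: eqVneq => //= ->; case: eqVneq => //= ->; rewrite eqxx.
rewrite orbF; move: xC yC; rewrite !in_setU.
case/orP=> xi; case/orP=> yi.
- by rewrite (negbTE (core_indepA H xi yi)) xi (AB y) // (AB x) ?andbF.
- by rewrite (missing0 M0 xi yi) xi yi.
- by rewrite adj_sym (missing0 M0 yi xi) xi yi orbT.
by rewrite (negbTE (core_indepB H xi yi)) yi (BA y) // (BA x) ?andbF.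
Qed.

(** * Upper bounds and the equality case *)

(** The greedy extension starts with degree bound [#|Y|.+1]: a remaining vertex has at most one
    neighbour in [C] and at most [#|Y|] in [Y]. *)
Lemma gamma2_greedy (G : sgraph) (C Y : {set G}) S :
  Y \subset ~: C -> uncut S (C :|: Y) = set0 ->
  (forall u, u \in ~: C :\: Y -> deg u C <= 1) ->
  gamma2 G + two_cliques #|Y|.+1 <= two_cliques #|~: C|.+1.
Proof.
move=> sY hS hdeg;
  have [||S' hS'] := @greedy_cut G (~: C :\: Y) S (C :|: Y) #|Y|.+1.
- by rewrite setDE -setCU -setI_eq0 setIC setICr.
- move=> u /hdeg du; apply: leq_trans (deg_U _ _ _) _.
  by rewrite -add1n leq_add ?deg_le.
have eT : (~: C :\: Y) :|: (C :|: Y) = [set: G].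
  by rewrite setDE -setCU setUC setUCr.
have := gamma2_le S'; rewrite eT hS cards0 in hS'.
have -> : #|~: C|.+1 = #|Y|.+1 + #|~: C :\: Y|.
  by rewrite addSn -(cardsID Y (~: C)) (setIidPr sY).
by move: hS'; clear; lia.
Qed.

Lemma core_bounds (G : sgraph) n k r (A B : {set G}) :
  3 <= r <= 2 * k -> 2 <= k -> #|G| = n ->
  (n - r + 1) ^ 2 %/ 4 + 'C(r, 2) <= #|edges G| ->
  core A B -> #|~: (A :|: B)| <= r.-1 ->
  (3 <= k \/ #|~: (A :|: B)| = r.-1 -> tied A B) ->
  d2 G < r - 2 /\ gamma2 G < two_cliques r \/
  [/\ is_Tstar r n G, d2 G <= r - 2 & gamma2 G <= two_cliques r].
Proof.
move=> hr k2 cG he H hp hT.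
have r3 : 3 <= r by case/andP: hr.
have fr : 0 < two_cliques r by apply: (@two_cliques_mono 3).
have gP : gamma2 G <= 'C(#|~: (A :|: B)|, 2).
  exact: leq_trans (gamma2_le _) (uncut_outside H).
have d2Y (S Y : {set G}) : Y \subset ~: (A :|: B) ->
  uncut S ((A :|: B) :|: Y) = set0 ->
    d2 G <= #|~: (A :|: B)| - #|Y|.
  move=> sY hS; apply: leq_trans (d2_le hS) _; rewrite setCU -setDE cardsD.
  by rewrite (setIidPr sY).
have dP u : u \in ~: (A :|: B) -> d2 G <= #|~: (A :|: B)| - 1.
  move=> uP; have [S hS] := uncut_single H uP; rewrite -(cards1 u).
  by apply: d2Y hS; rewrite sub1set.
have [p1|p2] := leqP #|~: (A :|: B)| 1.
  left; split; last by apply: leq_ltn_trans gP _; rewrite bin_small.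
  have := uncut_outside H; rewrite bin_small // leqn0 cards_eq0 => /eqP u0.
  by apply: leq_ltn_trans (d2_le u0) _; rewrite setCT cards0 subn_gt0.
have [u uP] : exists u, u \in ~: (A :|: B) by apply/card_gt0P; apply: ltnW.
have {dP} du := dP u uP.
have [/orP hT'|] := boolP ((3 <= k) || (#|~: (A :|: B)| == r.-1)); last first.
  rewrite negb_or -ltnNge ltnS => /andP[k3 pr]; left.
  have [ep er] : #|~: (A :|: B)| = 2 /\ r = 4.
    by move: hp p2 k3 pr hr k2; clear; lia.
  rewrite ep er in du gP *; split; first by apply: leq_ltn_trans du _.
  exact: leq_ltn_trans gP _.
have {}hT : tied A B.
  by apply: hT; case: hT' => [|/eqP]; [left | right].
have [[Y [S [sY cY hS hdeg]]]|[w wC [hw hcl]]] := core_dichotomy H hT p2.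
  (* Keeping two outside vertices gives at most r-3 deletions, and the positive term
     [two_cliques #|Y|.+1] makes the second bound strict. *)
  left; split; first by have := d2Y S Y sY hS; move: hp cY r3; clear; lia.
  have := gamma2_greedy sY hS hdeg.
  have : two_cliques #|~: (A :|: B)|.+1 <= two_cliques r.
    by apply: two_cliques_mono; move: hp r3; clear; lia.
  have : 0 < two_cliques #|Y|.+1 by apply: (@two_cliques_mono 3).
  by clear; lia.
have g1 : gamma2 G <= two_cliques #|~: (A :|: B)|.+1.
  have [S hS] := uncut_single H uP.
  apply: leq_trans (leq_addr _ _) (gamma2_greedy (Y := [set u]) _ hS _).
    by rewrite sub1set.
  by move=> v /setDP[vP _]; rewrite /deg hw ?cards1.
have [pr|pr] := leqP r.-1 #|~: (A :|: B)|.
  have ep : #|~: (A :|: B)| = r.-1 by apply/eqP; rewrite eqn_leq hp.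
  right; rewrite ep in g1 du; split.
  - by apply: core_Tstar H cG _ ep he wC hw hcl; apply: ltnW.
  - by move: du; clear; lia.
  by move: g1; rewrite prednK //; apply: ltnW; apply: ltnW.
(* Fewer than r-1 outside vertices save at least the last increment [r.-1./2], which is positive. *)
left; split; first by move: du pr p2; clear; lia.
have : two_cliques #|~: (A :|: B)|.+1 <= two_cliques r.-1
  by exact: two_cliques_mono.
have : two_cliques r = two_cliques r.-1 + r.-1./2.
  by rewrite -two_cliquesS prednK //; apply: ltnW; apply: ltnW.
have : 0 < r.-1./2 by rewrite half_gt0; move: r3; clear; lia.
by move: g1; clear; lia.
Qed.

Theorem theorem1p9 (n k r : nat) (hk : 2 <= k) (hr : 3 <= r <= 2 * k)
  (hn : 2 * (r + 2) * (r + 1) * (r + 2 * k) <= n)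
  (G : sgraph) (hG : #|G| = n) (hfree : cycle_free (2 * k + 1) G)
  (he : (n - r + 1) ^ 2 %/ 4 + 'C(r, 2) <= #|edges G|) :
  [/\ d2 G <= r - 2,
      gamma2 G <= 'C(r./2, 2) + 'C(uphalf r, 2),
      d2 G = r - 2 <-> is_Tstar r n G &
      gamma2 G = 'C(r./2, 2) + 'C(uphalf r, 2) <-> is_Tstar r n G].
Proof.
rewrite -/(two_cliques r).
have [A [B [H hp hT]]] := core_exists hG hk hr hn hfree he.
(* These lower bounds turn the non-strict alternative of [core_bounds] into equality and exclude
   [is_Tstar] in the strict one. *)
have lower : is_Tstar r n G -> r - 2 <= d2 G /\ two_cliques r <= gamma2 G.
  case/Tstar_clique => K <- hK.
  by split; [apply: clique_d2 | apply: clique_gamma2].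
case: (core_bounds hr hk hG he H hp hT) => [[d2lt g2lt]|[hTs d2le g2le]].
  split;
    [exact: ltnW | exact: ltnW | split=> [e|/lower[]] | split=> [e|/lower[]]].
  - by rewrite e ltnn in d2lt.
  - by rewrite leqNgt d2lt.
  - by rewrite e ltnn in g2lt.
  by move=> _; rewrite leqNgt g2lt.
have [d2ge g2ge] := lower hTs.
by split=> //; split=> // _; apply/eqP; rewrite eqn_leq ?d2le ?g2le.
Qed.
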